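(* Let $X$ be a real-valued Lévy process with diffusion coefficient $\sigma^2$, Lévy measure $\nu$ and drift $\gamma_0$, such that $\int (1\wedge|x|)\,\nu(dx)<\infty$, $\sigma^2=0$, $\nu((-\infty,0))>0$, $\nu((0,\infty))=0$ and $\gamma_0>0$. Let $M\in(0,\infty]$ and $a,b\in(0,\infty)$. Then one has both $\lambda_{a,b}^+([0,M))>0$ and $\lambda_{a,b}^-([0,M))>0$ if and only if $a/\gamma_0<M$.
   Context: $X=(X_t)_{t\ge 0}$ is a real-valued Lévy process (càdlàg paths, $X_0=0$ a.s., stationary independent increments) defined on a filtered probability space $(\Omega,\mathcal F,\mathbb F,\mathsf P)$ satisfying the standard assumptions, $X$ being $\mathbb F$-adapted. $\sigma^2\ge 0$ is its diffusion (Gaussian) coefficient and $\nu$ its Lévy measure (with $\nu(\{0\})=0$). When $\int(1\wedge|x|)\,\nu(dx)<\infty$, the drift $\gamma_0\in\mathbb R$ is the constant such that, by the Lévy–Itô decomposition, $X_t=\gamma_0 t+G_t+\sum_{0<s\le t}\Delta X_s$, with $G$ a driftless Gaussian Lévy process of variance $\sigma^2t$ at time $t$. For $a,b\in(0,\infty)$ ($a=b$ allowed), $T_{a,b}(X)=\inf\{t\ge 0: X_t\in\mathbb R\setminus(-b,a)\}$ (with $\inf\emptyset=\infty$) is the first exit time of $X$ from $(-b,a)$. The measures $\lambda_{a,b}^{\pm}$ on the Borel sets of $[0,\infty)$ are defined by $\lambda_{a,b}^-(A)=\mathsf P(T_{a,b}(X)<\infty,\ X_{T_{a,b}(X)}\le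 -b,\ T_{a,b}(X)\in A)$ and $\lambda_{a,b}^+(A)=\mathsf P(T_{a,b}(X)<\infty,\ X_{T_{a,b}(X)}\ge a,\ T_{a,b}(X)\in A)$. *)

(* Defs.v *)
From HB Require Import structures.
From mathcomp Require Import all_boot all_order all_algebra.
From mathcomp Require Import all_classical all_reals all_analysis.

Set Implicit Arguments.
Unset Strict Implicit.
Unset Printing Implicit Defensive.

Import Order.TTheory GRing.Theory Num.Theory.
Import numFieldNormedType.Exports.

Local Open Scope classical_set_scope.
Local Open Scope ring_scope.

(* Time is indexed by R; only times t >= 0 are ever constrained, and the
   values of a process or a filtration at negative times are irrelevant. *)

Section processes.
Context d (Omega : measurableType d) (R : realType) (P : probability Omega R).
Implicit Types (F : R -> set (set Omega)) (X G : R -> Omega -> R).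

Record filtration F : Prop := Filtration {
  filtration_sigma : forall t, 0 <= t -> sigma_algebra setT (F t) ;
  filtration_measurable : forall t, 0 <= t -> F t `<=` measurable ;
  filtration_mono : forall s t, 0 <= s -> s <= t -> F s `<=` F t }.

Record usual_conditions F : Prop := UsualConditions {
  usual_filtration : filtration F ;
  usual_complete : measure_is_complete P ;
  usual_null : forall N, P.-negligible N -> F 0 N ;
  usual_right_continuous :
    forall t, 0 <= t -> F t = \bigcap_(u in [set u | t < u]) F u }.

Definition adapted F X : Prop :=
  forall t, 0 <= t -> forall B : set R, measurable B -> F t (X t @^-1` B).

Definition cadlag (f : R -> R) : Prop :=
  (forall t, 0 <= t -> f u @[u --> t^'+] --> f t) /\
  (forall t, 0 < t -> cvg (f u @[u --> t^'-])).

(* Independence is the product rule for all Borel sets B i; since B i = setT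
   is allowed, it covers every subfamily of the increments. *)
Definition independent_increments X : Prop :=
  forall (n : nat) (t : nat -> R) (B : nat -> set R),
    0 <= t 0%N -> (forall i, (i < n)%N -> t i <= t i.+1) ->
    (forall i, (i < n)%N -> measurable (B i)) ->
    P (\bigcap_(i in `I_n) [set w | B i (X (t i.+1) w - X (t i) w)]) =
    (\prod_(i < n) P [set w | B i (X (t i.+1) w - X (t i) w)%R])%E.

Definition stationary_increments X : Prop :=
  forall s h, 0 <= s -> 0 <= h -> forall B : set R, measurable B ->
    P [set w | B (X (s + h) w - X s w)] = P [set w | B (X h w - X 0 w)].

Record levy_process X : Prop := LevyProcess {
  levy_measurable : forall t, 0 <= t -> measurable_fun setT (X t) ;
  levy_cadlag : forall w, cadlag (X ^~ w) ;
  levy_start : {ae P, forall w, X 0 w = 0} ;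
  levy_independent : independent_increments X ;
  levy_stationary : stationary_increments X }.

Definition jump (f : R -> R) (t : R) : R := f t - lim (f u @[u --> t^'-]).

(* nu A is the expected number of jumps of size in A over the time interval
   ]0, 1]; the library's [counting S] is the cardinality of S, +oo if S is
   infinite. *)
Definition levy_measure X (nu : {measure set R -> \bar R}) : Prop :=
  nu [set 0] = 0%E /\
  forall A : set R, measurable A -> ~ A 0 ->
    nu A =
    (\int[P]_w counting [set s | (0 < s <= 1)%R /\ A (jump (X ^~ w) s)])%E.

(* Normal law of mean 0 and variance v. The library's [normal_prob] is not
   the Dirac mass when its standard deviation is 0. *)
Definition centered_gaussian (v : R) (B : set R) : \bar R :=
  if v == 0 then dirac (0 : R) B else normal_prob 0 (Num.sqrt v) B.

Definition gaussian_levy (sigma2 : R) G : Prop :=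
  levy_process G /\
  forall t, 0 <= t -> forall B : set R, measurable B ->
    P (G t @^-1` B) = centered_gaussian (sigma2 * t) B.

(* The sum over 0 < s <= t of jump f s, as the sum of the positive jumps minus
   that of the sizes of the negative ones. In the extended reals it is finite
   only if both are finite, i.e. only if the jumps are absolutely summable. *)
Definition sum_jumps (f : R -> R) (t : R) : \bar R :=
  (\esum_(s in [set s | (0 < s <= t)%R]) (Num.max (jump f s) 0)%R%:E -
   \esum_(s in [set s | (0 < s <= t)%R]) (Num.max (- jump f s) 0)%R%:E)%E.

(* Diffusion coefficient sigma2 and drift gamma0 of a Levy process whose jumps
   are summable, as given by the Levy-Ito decomposition
   X_t = gamma0 t + G_t + sum_(0 < s <= t) (jump of X at s). *)
Definition diffusion_drift X (sigma2 gamma0 : R) : Prop :=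
  0 <= sigma2 /\
  exists G, gaussian_levy sigma2 G /\
    {ae P, forall w, forall t, 0 <= t ->
      (X t w)%:E = ((gamma0 * t + G t w)%R%:E + sum_jumps (X ^~ w) t)%E}.

Definition exit_time X (a b : R) (w : Omega) : \bar R :=
  ereal_inf (EFin @` [set t | 0 <= t /\ ~ (- b < X t w < a)]).

Definition lambda_minus X (a b : R) (A : set R) : \bar R :=
  P [set w | let T := exit_time X a b w in
    [/\ (T < +oo)%E, X (fine T) w <= - b & A (fine T)]].

Definition lambda_plus X (a b : R) (A : set R) : \bar R :=
  P [set w | let T := exit_time X a b w in
    [/\ (T < +oo)%E, a <= X (fine T) w & A (fine T)]].

End processes.

(* Main.v *)
(* Since sigma2 = 0 and X has no positive jumps, almost surely
   X t = gamma0 t - S t, where S is nondecreasing and equal to the sum of its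
   jumps. Hence X t <= gamma0 t and level a cannot be reached before a / gamma0.

   Conversely, sampling a pure jump path on a grid of mesh h shows that the
   proportion of cells on which S grows by more than eta h tends to 0 with h;
   by stationarity P (S h > eta h) -> 0, and multiplying over independent cells
   P (S t <= eta) > 0 for all t and eta. On this event X follows its drift and
   leaves through a shortly after a / gamma0. A jump of size at least e occurs
   with positive probability, so that S h >= e has positive probability for
   arbitrarily small h; juxtaposing many such cells leads X below - b before
   time a / gamma0.

   The exit events must also be shown to be measurable. They are determined by
   countably many times as soon as X never jumps down from the level a, i.e.
   never satisfies X (s-) = a > X s. On a grid of mesh T / n such a jump forces a
   cell that starts near a and on which S grows by at least k. The second event
   is independent of the first and has probability O(1 / n), because the
   probability that none of the n cells has such a growth is bounded below; the
   expected proportion of grid times spent near a is small, because X moves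
   with a speed close to gamma0 on most blocks of cells. *)
Require Import Defs.
From HB Require Import structures.
From mathcomp Require Import all_boot all_order all_algebra.
From mathcomp Require Import all_classical all_reals all_analysis.
From mathcomp Require Import measurable_realfun ring lra.
Import Order.TTheory GRing.Theory Num.Theory.
Import numFieldNormedType.Exports.
Set Implicit Arguments.
Unset Strict Implicit.
Unset Printing Implicit Defensive.
Local Open Scope classical_set_scope.
Local Open Scope ring_scope.

(** * Paths that are sums of their jumps *)

Section path.
Context (R : realType).
Implicit Types (c f S : R -> R).

Lemma cadlag_right f t e : cadlag f -> 0 <= t -> 0 < e ->
  exists2 r, 0 < r & forall u, t <= u < t + r -> `|f u - f t| < e.
Proof.
move=> [fr _] t0 e0; have /cvgrPdist_lt /(_ e e0) := fr t t0.
rewrite near_withinE => /nbhs_ballP[r /= r0 H]; exists r => // u /andP[tu ur].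
have [->|ut] := eqVneq u t; first by rewrite subrr normr0.
rewrite distrC; apply: H; last by rewrite lt_neqAle eq_sym ut.
by rewrite /ball /= ltr_distl; apply/andP; split; lra.
Qed.

Lemma cadlag_left f t e : cadlag f -> 0 < t -> 0 < e ->
  exists2 r, 0 < r &
    forall u, t - r < u < t -> `|f u - lim (f x @[x --> t^'-])| < e.
Proof.
move=> [_ fl] t0 e0; have /cvgrPdist_lt /(_ e e0) := fl t t0.
rewrite near_withinE => /nbhs_ballP[r /= r0 H]; exists r => // u /andP[tu ur].
rewrite distrC; apply: H => //.
by rewrite /ball /= ltr_distl; apply/andP; split; lra.
Qed.

(** [c s] is the size of the jump at s. The sum is taken in the extended reals, so that its equality
    with the real number [S t] includes its finiteness. *)
Definition pure_jump c S : Prop :=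
  (forall s, 0 <= c s) /\
  forall t, 0 <= t -> (S t)%:E = (\esum_(s in [set s | (0 < s <= t)%R]) (c s)%:E)%E.

Lemma pure_jump0 c S : pure_jump c S -> S 0 = 0.
Proof.
move=> [c0 cS]; have := cS 0 (lexx _).
rewrite (_ : [set s | _] = set0) ?esum_set0; first by case.
by apply/seteqP; split => x //= /andP[x0]; rewrite leNgt x0.
Qed.

Lemma pure_jump_split c S s t : pure_jump c S -> 0 <= s -> s <= t ->
  (S t - S s)%:E = (\esum_(r in [set r | (s < r <= t)%R]) (c r)%:E)%E.
Proof.
move=> [c0 cS] s0 st; have := cS t (le_trans s0 st).
rewrite (esumID [set r | r <= s]); last by move=> i _; rewrite lee_fin.
rewrite (_ : _ `&` [set r | r <= s] = [set r | 0 < r <= s]); last first.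
  by apply/seteqP; split => x /=; lra.
rewrite -cS// (_ : _ `&` _ = [set r | s < r <= t]); last first.
  apply/seteqP; split => x /=; first by move=> [? /negP]; rewrite -ltNge; lra.
  by move=> H; split; [lra | apply/negP; rewrite -ltNge; lra].
move=> H; rewrite EFinB H addeAC subee// add0e//.
Qed.

Lemma pure_jump_mono c S s t : pure_jump c S -> 0 <= s -> s <= t -> S s <= S t.
Proof.
move=> cS s0 st; rewrite -subr_ge0 -lee_fin (pure_jump_split cS)//.
by apply: esum_ge0 => x _; rewrite lee_fin; apply cS.1.
Qed.

Lemma pure_jump_sum c S s t (D : seq R) : pure_jump c S -> uniq D ->
  0 <= s -> s <= t -> \sum_(x <- D | s < x <= t) c x <= S t - S s.
Proof.
move=> cS uD s0 st; rewrite -lee_fin (pure_jump_split cS)//.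
apply: esum_ge; exists [set` [seq x <- D | s < x <= t]].
  split; first exact: finite_seq.
  by move=> x /=; rewrite mem_filter => /andP[].
rewrite -fsbig_seq ?filter_uniq// sumEFin lee_fin big_filter.
exact: lexx.
Qed.

Lemma pure_jump_ge c S s t r : pure_jump c S -> 0 <= s -> s < r <= t ->
  c r <= S t - S s.
Proof.
move=> cS s0 /andP[sr rt].
have := @pure_jump_sum c S s t [:: r] cS isT s0 (le_trans (ltW sr) rt).
by rewrite big_cons big_nil sr rt addr0.
Qed.

Lemma pure_jump_approx c S T d : pure_jump c S -> 0 <= T -> 0 < d ->
  exists D : seq R, [/\ uniq D, {in D, forall x, 0 < x <= T} &
    S T - d < \sum_(x <- D) c x].
Proof.
move=> cS T0 d0; have H := cS.2 _ T0.
have : ((S T - d)%:E < \esum_(s in [set s | (0 < s <= T)%R]) (c s)%:E)%E.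
  by rewrite -H lte_fin; lra.
move=> /ereal_sup_gt[_ [A [finA AT] <-]].
rewrite fsbig_finite//= sumEFin lte_fin => ?.
exists (finmap.enum_fset (fset_set A)); split => //; first exact: finmap.fset_uniq.
move=> x.
by rewrite in_fset_set// inE => /AT.
Qed.

(** The half-open cells partition ]0, n h]. Each indicator is a difference of two indicators of
    half-lines, so the sum telescopes. *)
Lemma sum_cells (h : R) n x : 0 < h -> 0 < x -> x <= n%:R * h ->
  \sum_(i < n) ((i%:R * h < x) && (x <= i.+1%:R * h))%:R = 1 :> R.
Proof.
move=> h0 x0 xn.
rewrite (eq_bigr (fun i : 'I_n => (x <= i.+1%:R * h)%R%:R - (x <= i%:R * h)%R%:R)).
  rewrite -(big_mkord xpredT
    (fun i => (x <= i.+1%:R * h)%R%:R - (x <= i%:R * h)%R%:R : R)).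
  by rewrite telescope_sumr// xn mul0r leNgt x0 subr0.
move=> i _; have hi : i%:R * h <= i.+1%:R * h by rewrite ler_pM2r// ler_nat.
case: (leP x (i%:R * h)) => /= H; first by rewrite (le_trans H hi) subrr.
by rewrite subr0.
Qed.

Lemma exists_cell (h : R) n x : 0 < h -> 0 < x -> x <= n%:R * h ->
  exists2 i, (i < n)%N & (i%:R * h < x) && (x <= i.+1%:R * h).
Proof.
move=> h0 x0 xn; apply/not_exists2P => H.
have := sum_cells h0 x0 xn; rewrite big1 => [/esym/eqP|i _]; first by rewrite oner_eq0.
have [/(_ (ltn_ord i))//|/negP/negbTE ->//] := H i.
Qed.

(* All but d of the growth of S comes from finitely many jumps, which lie in K cells;
   the number of the other cells is at most d / (eta h) by Markov's inequality. *)
Lemma pure_jump_count c S T d eta : pure_jump c S -> 0 <= T -> 0 < d ->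
  0 < eta -> exists K : R, forall n (h : R), 0 < h -> n%:R * h = T ->
  \sum_(i < n) (eta * h < S (i.+1%:R * h) - S (i%:R * h))%R%:R <= K + d / (eta * h).
Proof.
move=> cS T0 d0 eta0; have [D [uD DT Dd]] := pure_jump_approx cS T0 d0.
exists (size D)%:R => n h h0 nh; have eh0 : 0 < eta * h by exact: mulr_gt0.
pose cell i x : bool := (i%:R * h < x) && (x <= i.+1%:R * h).
pose inc i := S (i.+1%:R * h) - S (i%:R * h).
have ih i : 0 <= i%:R * h by rewrite mulr_ge0// ltW.
have hS i : i%:R * h <= i.+1%:R * h by rewrite ler_pM2r// ler_nat.
apply: (@le_trans _ _ (\sum_(i < n) (\sum_(x <- D) (cell i x)%:R +
    (inc i - \sum_(x <- D | cell i x) c x) / (eta * h)))).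
  apply: ler_sum => i _; have inc0 : 0 <= inc i - \sum_(x <- D | cell i x) c x.
    by rewrite subr_ge0; exact: pure_jump_sum.
  have s0 : 0 <= \sum_(x <- D) (cell i x)%:R :> R by exact: sumr_ge0.
  case: (boolP (has (cell i) D)) => [/hasP[x xD cx]|/hasPn nD].
    rewrite (@le_trans _ _ 1)//; first by case: (_ < _).
    rewrite -[leLHS]addr0 lerD//; last by rewrite divr_ge0// ltW.
    rewrite (big_rem x)//= cx lerDl; exact: sumr_ge0.
  rewrite big_seq big1; last by move=> x /nD /negbTE ->.
  rewrite add0r (_ : \sum_(x <- D | cell i x) c x = 0) ?subr0; last first.
    by rewrite big_seq_cond big1// => x /andP[/nD /negbTE ->].
  rewrite ler_pdivlMr// /inc; case: ltP => [/ltW|_]; first by rewrite mul1r.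
  by rewrite mul0r subr_ge0 (pure_jump_mono cS).
rewrite big_split /= exchange_big /= lerD//.
  rewrite big_seq (eq_bigr (fun=> 1)) => [|x /DT /andP[x0 xT]]; last first.
    by rewrite sum_cells// nh.
  by rewrite -big_seq big_const_seq iter_addr_0 count_predT.
rewrite -mulr_suml ler_pM2r ?invr_gt0// sumrB.
have -> : \sum_(i < n) inc i = S T.
  rewrite -(big_mkord xpredT inc) telescope_sumr// nh mul0r.
  by rewrite (pure_jump0 cS) subr0.
have -> : \sum_(i < n) \sum_(x <- D | cell i x) c x = \sum_(x <- D) c x.
  under eq_bigr do rewrite big_mkcond.
  rewrite exchange_big /= big_seq [RHS]big_seq; apply: eq_bigr => x /DT /andP[x0 xT].
  rewrite -[RHS]mulr1 -(@sum_cells h n x)// ?nh// mulr_sumr.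
  by apply: eq_bigr => i _; rewrite -/(cell i x); case: (cell i x); rewrite ?mulr1 ?mulr0.
lra.
Qed.

End path.

(** * Cadlag paths *)

Section cadlag_path.
Context (R : realType).
Implicit Types f : R -> R.

(** Compactness of [a, b] turns a radius that depends on the point into a uniform one. The same r
    bounds the neighbourhood and is the parameter of [P], which may be shrunk. *)
Lemma near_segment_uniform (P : R -> R -> Prop) (a b : R) :
  (forall e e' x, 0 < e' -> e' <= e -> P e x -> P e' x) ->
  (forall x, a <= x <= b -> exists2 r, 0 < r &
     forall y, `|y - x| < r -> a <= y <= b -> P r y) ->
  exists2 e, 0 < e & forall x, a <= x <= b -> P e x.
Proof.
move=> Pmono H.
have /compact_near_coveringP cov := @segment_compact R a b.
have [r /= r0 Hr] : \forall e \near (0 : R)^'+,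
    `[a, b] `<=` (fun x => a <= x <= b -> P e x).
  apply: (cov R (0 : R)^'+ (fun e x => a <= x <= b -> P e x)).
  move=> x; rewrite /= in_itv /= => /H[r r0 Hr].
  exists (ball x r, [set e | 0 < e <= r]) => /=.
    split; first exact: nbhsx_ballx.
    by near=> e; apply/andP; split=> //; near: e; exact: nbhs_right_le.
  move=> [y e] /= [xy /andP[e0 er]] yab; apply: Pmono er _ => //.
  by apply: Hr => //; rewrite distrC.
exists (r / 2); first by rewrite divr_gt0.
move=> x xab; apply: (Hr (r / 2)) => //=.
- by rewrite sub0r normrN gtr0_norm ?divr_gt0//; lra.
- by rewrite divr_gt0.
Unshelve. all: by end_near. Qed.

(** The supremum over a compact interval is approached at a value or at a left limit, and both are
    below c; compactness makes the local gaps uniform. *)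
Lemma cadlag_lt_sup f c u : cadlag f -> 0 <= u ->
  (forall s, 0 <= s <= u -> f s < c) ->
  (forall s, 0 < s <= u -> lim (f x @[x --> s^'-]) < c) ->
  exists2 e, 0 < e & forall s, 0 <= s <= u -> f s <= c - e.
Proof.
move=> cf u0 H1 H2.
apply: (@near_segment_uniform (fun e s => f s <= c - e)) => [|s su].
  by move=> e e' x e0 ee; lra.
have s0 : 0 <= s by case/andP: su.
have fs := H1 s su.
have [r r0 Hr] := @cadlag_right _ f s ((c - f s) / 2) cf s0 ltac:(lra).
have [s00|s1] := leP s 0.
  have es : s = 0 by lra.
  exists (Num.min r ((c - f s) / 2)); first by rewrite lt_min r0; lra.
  move=> y; rewrite lt_min ltr_distl => /andP[/andP[_ yr] _] /andP[y0 yu].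
  have := Hr y ltac:(lra); rewrite ltr_distl => /andP[_].
  have : Num.min r ((c - f s) / 2) <= (c - f s) / 2 by rewrite ge_min lexx orbT.
  lra.
have fl := H2 s ltac:(lra); set L := lim _ in fl.
have [r' r'0 Hr'] := @cadlag_left _ f s ((c - L) / 2) cf s1 ltac:(lra).
set m := Num.min (Num.min r r') (Num.min ((c - f s) / 2) ((c - L) / 2)).
have [m1 m2 m3 m4] : [/\ m <= r, m <= r', m <= (c - f s) / 2 & m <= (c - L) / 2].
  by rewrite /m !ge_min !lexx !orbT; split.
have m0 : 0 < m by rewrite /m !lt_min; lra.
exists m => // y; rewrite ltr_distl => /andP[y1 y2] yu.
have [ys|ys] := ltP y s.
  by have := Hr' y ltac:(lra); rewrite -/L ltr_distl => /andP[_]; lra.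
by have := Hr y ltac:(lra); rewrite ltr_distl => /andP[_]; lra.
Qed.

(** Around s, two times on the same side of s have values within e of each other; crossing s adds
    the jump, which is at most 0. *)
Lemma no_jump_small_increments f e : cadlag f -> 0 < e ->
  (forall s, 0 < s <= 1 -> jump f s <= 0) ->
  exists2 d, 0 < d & forall x y, 0 <= x -> x <= y -> y <= 1 -> y < x + d ->
    f y - f x < e.
Proof.
move=> cf e0 H.
suff [d d0 Hd] : exists2 d, 0 < d & forall x, 0 <= x <= 1 ->
    forall y, x <= y <= 1 -> y < x + d -> f y - f x < e.
  by exists d => // x y ? ? ? ?; apply: Hd; lra.
apply: near_segment_uniform => [d d' x ? ? + y *|s s01].
  by apply; lra.
have s0 : 0 <= s by case/andP: s01.
have [r r0 Hr] := @cadlag_right _ f s (e / 2) cf s0 ltac:(lra).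
have [s00|s1] := leP s 0.
  exists (r / 2) => [|x]; first lra.
  rewrite ltr_distl => /andP[x1 x2] x01 y xy yx.
  have := Hr x ltac:(lra); have := Hr y ltac:(lra).
  by rewrite !ltr_distl => /andP[? ?] /andP[? ?]; lra.
have := H s ltac:(lra); rewrite /jump; set L := lim _ => fL.
have [r' r'0 Hr'] := @cadlag_left _ f s (e / 2) cf s1 ltac:(lra).
set m := Num.min (r / 2) r'.
have [m1 m2] : m <= r / 2 /\ m <= r' by rewrite /m !ge_min !lexx !orbT.
have m0 : 0 < m by rewrite /m !lt_min; lra.
exists m => // x; rewrite ltr_distl => /andP[x1 x2] x01 y xy yx.
have [ys|ys] := ltP y s.
  have := Hr' x ltac:(lra); have := Hr' y ltac:(lra).
  by rewrite -/L !ltr_distl => /andP[? ?] /andP[? ?]; lra.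
have := Hr y ltac:(lra); rewrite ltr_distl => /andP[? ?].
have [xs|xs] := ltP x s.
  by have := Hr' x ltac:(lra); rewrite -/L ltr_distl => /andP[? ?]; lra.
by have := Hr x ltac:(lra); rewrite ltr_distl => /andP[? ?]; lra.
Qed.

Lemma jump_increment f s e : cadlag f -> 0 < s -> e < jump f s ->
  exists2 d, 0 < d & forall x y, x < s <= y -> y < x + d -> e <= f y - f x.
Proof.
move=> cf s0; rewrite /jump; set L := lim _ => ej.
have [r r0 Hr] := @cadlag_right _ f s ((f s - L - e) / 2) cf (ltW s0) ltac:(lra).
have [r' r'0 Hr'] := @cadlag_left _ f s ((f s - L - e) / 2) cf s0 ltac:(lra).
exists (Num.min r r'); first by rewrite lt_min r0.
move=> x y /andP[xs sy] yx.
have : y < x + r /\ y < x + r' by move: yx; case: (leP r r'); lra.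
move=> [y1 y2]; have := Hr y ltac:(lra); have := Hr' x ltac:(lra).
by rewrite -/L !ltr_distl => /andP[? ?] /andP[? ?]; lra.
Qed.

(** By right continuity, rational times slightly to the right of s decide about s. The endpoint u
    has its own hypothesis, as no later time is available there. *)
Lemma cadlag_rat_le f c u : cadlag f -> 0 <= u -> f u <= c ->
  (forall q : rat, 0 <= (ratr q : R) <= u -> f (ratr q) <= c) ->
  forall s, 0 <= s <= u -> f s <= c.
Proof.
move=> cf u0 fu H s /andP[s0]; rewrite le_eqVlt => /predU1P[->//|su].
rewrite leNgt; apply/negP => cs.
have [r r0 Hr] := @cadlag_right _ f s (f s - c) cf s0 ltac:(lra).
have [q] := @rat_in_itvoo R s (Num.min u (s + r)) ltac:(by rewrite lt_min su; lra).
rewrite in_itv/= lt_min => /andP[sq /andP[qu qr]].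
have := H q ltac:(lra); have := Hr (ratr q) ltac:(lra).
by rewrite ltr_distl => /andP[]; lra.
Qed.

(** What a grid sees of a jump down from the level a: the cell that straddles s starts near a, and
    [g * x - f x] grows there by the depth e of the jump, up to the error e / 2 made in replacing
    the left limit by [f x]. *)
Lemma left_limit_increment f g s a e d : cadlag f -> 0 < s -> 0 < g ->
  (forall x y, 0 <= x -> x <= y -> g * x - f x <= g * y - f y) ->
  lim (f x @[x --> s^'-]) = a -> f s <= a - e -> 0 < e -> 0 < d ->
  exists2 r, 0 < r & forall x y, 0 <= x -> x < s <= y -> y < x + r ->
    `|f x - a| <= d /\ e / 2 <= (g * y - f y) - (g * x - f x).
Proof.
move=> cf s0 g0 mono La fs e0 d0.
have [r r0 Hr] := @cadlag_left _ f s (Num.min d (e / 2)) cf s0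
  ltac:(by rewrite lt_min d0; lra).
exists r => // x y x0 /andP[xs sy] yx.
have := Hr x ltac:(lra); rewrite La lt_min => /andP[/ltW ? e2]; split=> //.
have := mono s y (ltW s0) sy; move: e2; rewrite ltr_distl => /andP[? ?].
have : g * x <= g * s by rewrite ler_pM2l// ltW.
lra.
Qed.

(** The indices satisfying [Q] lie between the smallest and the largest one, so they number at most
    their distance plus 1. *)
Lemma count_spread (Q : pred nat) n (C : R) : 0 <= C ->
  (forall i j, (i <= j < n)%N -> Q i -> Q j -> (j - i)%:R <= C) ->
  \sum_(i < n) (Q i)%:R <= C + 1.
Proof.
move=> C0 H.
suff : \sum_(i < n) (Q i)%:R = 0 :> R \/ exists i j, [/\ (i <= j < n)%N, Q i, Q j &
    \sum_(i < n) (Q i)%:R <= (j - i)%:R + 1 :> R].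
  move=> [->|[i [j [ij Qi Qj]]]]; first by lra.
  by move=> hle; apply: (le_trans hle); rewrite lerD2r; exact: (H i j).
elim: n {H} => [|n [IH|[i [j [/andP[ij jn] Qi Qj IH]]]]]; first by left; rewrite big_ord0.
  rewrite big_ord_recr /= IH add0r; case: (boolP (Q n)) => Qn; last by left.
  by right; exists n, n; rewrite leqnn ltnS leqnn subnn add0r.
right; rewrite big_ord_recr /=; case: (boolP (Q n)) => Qn.
  exists i, n; rewrite (leq_trans ij (ltnW jn)) ltnS leqnn; split => //.
  rewrite lerD2r; apply: (le_trans IH); rewrite natr1 ler_nat.
  by rewrite -subSn// leq_sub2r.
by exists i, j; rewrite ij (ltn_trans jn)// addr0; split.
Qed.

(* If S grows by at most eta h over a block of length h, two times of the block spent
   within d of the level a differ by at most (2 d + eta h) / g. *)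
Lemma occupation_count f g a u h d eta m : 0 < g -> 0 < h -> 0 <= u ->
  0 <= d -> 0 <= eta -> (0 < m)%N ->
  (forall x y, 0 <= x -> x <= y -> g * x - f x <= g * y - f y) ->
  (g * (u + h) - f (u + h)) - (g * u - f u) <= eta * h ->
  \sum_(i < m) (`|f (u + i%:R * (h / m%:R)) - a| <= d)%R%:R <=
    m%:R * ((2 * d + eta * h) / (g * h)) + 1.
Proof.
move=> g0 h0 u0 d0 eta0 m0 mono Su.
have m0' : 0 < m%:R :> R by rewrite ltr0n.
apply: (@count_spread
  (fun i => (`|f (u + i%:R * (h / m%:R)) - a| <= d)%R)) => [|i j /andP[ij jm]].
  have eh : 0 <= eta * h by apply: mulr_ge0 => //; exact: ltW.
  have gh : 0 <= (g * h)^-1 by rewrite invr_ge0; apply: mulr_ge0; exact: ltW.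
  by apply: mulr_ge0 => //; apply: mulr_ge0 => //; apply: addr_ge0 => //; lra.
have hm0 : 0 < h / m%:R by exact: divr_gt0.
rewrite !ler_distl => /andP[i1 i2] /andP[j1 j2].
have xx : u + i%:R * (h / m%:R) <= u + j%:R * (h / m%:R).
  by rewrite lerD2l ler_pM2r// ler_nat.
have ui : u <= u + i%:R * (h / m%:R) by rewrite lerDl mulr_ge0// ltW.
have uj : u + j%:R * (h / m%:R) <= u + h.
  by rewrite lerD2l mulrCA ger_pMr// ler_pdivrMr// mul1r ler_nat ltnW.
have := mono _ _ u0 ui; have := mono _ _ (le_trans u0 (le_trans ui xx)) uj.
move: Su; set x := u + i%:R * _ in i1 i2 xx ui *.
set y := u + j%:R * _ in j1 j2 xx uj * => Su M2 M1.
have K : g * (y - x) <= 2 * d + eta * h by lra.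
rewrite natrB//.
have -> : m%:R * ((2 * d + eta * h) / (g * h)) = (2 * d + eta * h) / (g * (h / m%:R)).
  by field; rewrite !gt_eqF.
have E : (j%:R - i%:R) * (g * (h / m%:R)) = g * (y - x) by rewrite /x /y; ring.
rewrite ler_pdivlMr; first by rewrite E.
exact: mulr_gt0.
Qed.

End cadlag_path.

(** * Probabilities as real numbers *)

Section probability_of_events.
Context d (Omega : measurableType d) (R : realType) (P : probability Omega R).
Implicit Types (A B : set Omega).

Definition pr A : R := fine (P A).

Lemma prE A : measurable A -> P A = (pr A)%:E.
Proof. by move=> mA; rewrite /pr fineK// fin_num_measure. Qed.

Lemma pr_ge0 A : 0 <= pr A.
Proof. exact: fine_ge0. Qed.

Lemma pr_le1 A : measurable A -> pr A <= 1.
Proof. by move=> mA; rewrite -lee_fin -prE// probability_le1. Qed.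

Lemma prC A : measurable A -> pr (~` A) = 1 - pr A.
Proof.
move=> mA; apply: EFin_inj; rewrite -prE; last exact: measurableC.
by rewrite probability_setC// prE.
Qed.

Lemma pr_ae_le A B : measurable A -> measurable B ->
  {ae P, forall w, A w -> B w} -> pr A <= pr B.
Proof.
move=> mA mB [N [mN N0 HN]]; rewrite -lee_fin -!prE//.
apply: (@le_trans _ _ (P (B `|` N))); last first.
  by apply: (le_trans (measureU2 _ _ _)) => //; rewrite [X in (_ + X)%E]N0 adde0.
apply: le_measure; rewrite ?inE//; first exact: measurableU.
move=> w Aw; have [Bw|nBw] := pselect (B w); first by left.
by right; apply: HN => /= /(_ Aw).
Qed.

Lemma integral_sum_indic n (E : nat -> set Omega) : (forall i, measurable (E i)) ->
  (\int[P]_w (\sum_(i < n) \1_(E i) w)%:E = (\sum_(i < n) pr (E i))%:E)%E.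
Proof.
move=> mE; under eq_integral do rewrite -sumEFin.
rewrite ge0_integral_sum//.
- rewrite -sumEFin; apply: eq_bigr => i _.
  by rewrite integral_indic// setIT; exact: prE.
- by move=> i; apply/measurable_EFinP; exact: measurable_indic.
Qed.

(** Expectation of an almost sure bound on the number of events that occur. *)
Lemma sum_pr_le n (E : nat -> set Omega) B (m C : R) :
  (forall i, measurable (E i)) -> measurable B -> 0 <= m -> 0 <= C ->
  {ae P, forall w, \sum_(i < n) \1_(E i) w <= m * \1_B w + C} ->
  \sum_(i < n) pr (E i) <= m * pr B + C.
Proof.
move=> mE mB m0 C0 H; rewrite -lee_fin -integral_sum_indic//.
have mf : measurable_fun setT (fun w => (m * \1_B w + C)%:E).
  by apply/measurable_EFinP; apply: measurable_funD => //; apply: measurable_funM.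
apply: (@le_trans _ _ (\int[P]_w (m * \1_B w + C)%:E)%E).
  apply: ae_ge0_le_integral => //.
  - by move=> w _; rewrite lee_fin; apply: sumr_ge0 => i _; exact: ler0n.
  - apply/measurable_EFinP; apply: measurable_sum => i; exact: measurable_indic.
  - by move=> w _; rewrite lee_fin addr_ge0// mulr_ge0// ler0n.
  - case: H => N [mN N0 HN]; exists N; split => // w /= nw.
    by apply: HN => /= h; apply: nw => _; rewrite lee_fin.
under eq_integral do rewrite EFinD EFinM.
rewrite ge0_integralD//.
- rewrite ge0_integralZl_EFin//.
  + rewrite integral_indic// setIT integral_cst// [X in (_ + _ * X)%E]probability_setT.
    by rewrite mule1 [X in (_ * X + _)%E]prE.
  + by apply/measurable_EFinP; exact: measurable_indic.
- by move=> w _; rewrite mule_ge0// lee_fin.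
- by apply: emeasurable_funM => //; apply/measurable_EFinP; exact: measurable_indic.
Qed.

Lemma pr_negligible A : P.-negligible A -> measurable A -> pr A = 0.
Proof. by move=> nA mA; rewrite /pr (measure_negligible mA nA). Qed.

(** Intersecting the sets B obtained for e = 1 / (k + 1) leaves a null set. The lemma is meant for
    sets A whose measurability is not known. *)
Lemma negligible_small A : (forall e : R, 0 < e -> exists B,
    [/\ measurable B, pr B <= e & P.-negligible (A `\` B)]) -> P.-negligible A.
Proof.
move=> H; pose u (k : nat) : R := k.+1%:R^-1.
have /choice[B HB] k : exists B,
    [/\ measurable B, pr B <= u k & P.-negligible (A `\` B)].
  by apply: H; rewrite invr_gt0.
have mB k : measurable (B k) by case: (HB k).
apply: (@negligibleS _ _ _ _ ((\bigcup_k (A `\` B k)) `|` \bigcap_k B k)).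
  move=> w Aw; have [|/existsNP[k nB]] := pselect (forall k, B k w).
    by move=> h; right => k _.
  by left; exists k.
apply: negligibleU; first by apply: negligible_bigcup => k; case: (HB k).
have mI : measurable (\bigcap_k B k) by exact: bigcapT_measurable.
apply/negligibleP => //; apply: (etrans (prE mI)); congr EFin.
apply/eqP; rewrite eq_le pr_ge0 andbT; apply/ler_addgt0Pl => e e0; rewrite addr0.
have [k ke] : exists k : nat, u k <= e.
  exists (Num.truncn e^-1); rewrite /u invf_ple ?posrE//.
  by apply: ltW; apply: truncnS_gt.
apply: le_trans ke; have [_ h _] := HB k; apply: le_trans h.
by apply: pr_ae_le => //; apply: aeW => w /(_ k I).
Qed.

End probability_of_events.

(** * Increments on a grid *)

Section levy_increments.
Context d (Omega : measurableType d) (R : realType) (P : probability Omega R).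
Variables (X : R -> Omega -> R) (hX : levy_process P X).
Implicit Types (B : set R).

Lemma measurable_increment B s t : measurable B -> 0 <= s -> 0 <= t ->
  measurable [set w | B (X t w - X s w)].
Proof.
move=> mB s0 t0; rewrite -[X in measurable X]setTI.
by apply: (measurable_funB (levy_measurable hX t0) (levy_measurable hX s0)).
Qed.

(** By stationarity, the probability that any increment of X over a time h lies in B; [X 0] is
    subtracted because it vanishes only almost surely. *)
Definition law h B : R := pr P [set w | B (X h w - X 0 w)].

Lemma law_ge0 h B : 0 <= law h B. Proof. exact: pr_ge0. Qed.

Lemma law_shift s h B : 0 <= s -> 0 <= h -> measurable B ->
  pr P [set w | B (X (s + h) w - X s w)] = law h B.
Proof. by move=> s0 h0 mB; rewrite /pr (levy_stationary hX). Qed.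

Lemma law_cell h i B : 0 <= h -> measurable B ->
  pr P [set w | B (X (i.+1%:R * h) w - X (i%:R * h) w)] = law h B.
Proof.
move=> h0 mB; rewrite -(@law_shift (i%:R * h))//; last by rewrite mulr_ge0.
by rewrite -[X in _ + X]mul1r -mulrDl natr1.
Qed.

Lemma pr_grid s h n B : 0 <= s -> 0 <= h -> measurable B ->
  pr P (\bigcap_(i in `I_n)
     [set w | B (X (s + i.+1%:R * h) w - X (s + i%:R * h) w)]) = law h B ^+ n.
Proof.
move=> s0 h0 mB; have ih i : 0 <= i%:R * h by rewrite mulr_ge0.
have m i : measurable [set w | B (X (s + i.+1%:R * h) w - X (s + i%:R * h) w)].
  by apply: measurable_increment => //; rewrite addr_ge0.
apply: EFin_inj; rewrite -prE; last by apply: bigcap_measurableType => i _; exact: m.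
rewrite (levy_independent hX (t := fun i => s + i%:R * h) (B := fun=> B))//=.
- rewrite (eq_bigr (fun=> (law h B)%:E)) => [|i _]; last first.
    rewrite prE// -(@law_shift (s + i%:R * h))//; last by rewrite addr_ge0.
    by rewrite -addrA -[X in _ + (_ + X)]mul1r -mulrDl natr1.
  elim: n => [|n IH]; first by rewrite big_ord0 expr0.
  by rewrite big_ord_recr /= IH -EFinM exprSr.
- by rewrite mul0r addr0.
- by move=> i _; rewrite lerD2l ler_wpM2r// ler_nat.
Qed.

Lemma pr_two t h B1 B2 : 0 <= t -> 0 <= h -> measurable B1 -> measurable B2 ->
  pr P ([set w | B1 (X t w - X 0 w)] `&` [set w | B2 (X (t + h) w - X t w)]) =
  law t B1 * law h B2.
Proof.
move=> t0 h0 mB1 mB2; have th : 0 <= t + h by rewrite addr_ge0.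
have m1 := measurable_increment mB1 (lexx 0) t0.
have m2 := measurable_increment mB2 t0 th.
apply: EFin_inj; rewrite -prE; last exact: measurableI.
(* The times are 0, t, t + h; the values at further indices are defaults. *)
have := levy_independent hX (n := 2%N)
  (t := fun i => if i is i'.+1 then (if i' is 0%N then t else t + h) else 0)
  (B := fun i => if i is 0%N then B1 else B2).
rewrite !big_ord_recr big_ord0 /= mul1e => H.
rewrite EFinM -(@law_shift t h)// /law -!prE// -H//.
- congr (P _); apply/seteqP; split => w /=.
    by move=> [? ?] [|[|]].
  by move=> H'; split; [apply: (H' 0%N)|apply: (H' 1%N)].
- by move=> [|[|]]//= _; rewrite lerDl.
- by move=> [|].
Qed.

Variables (g : R) (c : Omega -> R -> R).
Hypothesis g0 : 0 < g.
Hypothesis hS : {ae P, forall w, pure_jump (c w) (fun t => g * t - X t w)}.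

Let S w t : R := g * t - X t w.

Lemma indic_bool (T : Type) (b : T -> bool) w : \1_[set w | b w] w = (b w)%:R :> R.
Proof.
by rewrite indicE; case: (boolP (b w)) => h; [rewrite mem_set|rewrite memNset// => /=; exact/negP].
Qed.

(* If x is the increment of X over a time h, then g * h - x is that of S. *)
Definition drop_set (e h : R) : set R := [set x | e < g * h - x].

Lemma measurable_drop e h : measurable (drop_set e h).
Proof.
rewrite (_ : drop_set e h = [set` `]-oo, (g * h - e)[]); first exact: measurable_itv.
by apply/seteqP; split => x; rewrite /drop_set /= in_itv /=; lra.
Qed.

Lemma dropE e h i w : drop_set e h (X (i.+1%:R * h) w - X (i%:R * h) w) =
  (e < S w (i.+1%:R * h) - S w (i%:R * h)) :> Prop.
Proof. by congr (is_true (_ < _)); rewrite /S -natr1; ring. Qed.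

(** By stationarity this probability is the expected proportion of the n + 1 cells of [0, T] on
    which S grows by more than eta times their length. The proportion tends to 0 on each pure jump
    path and is at most 1, so dominated convergence applies. *)
Lemma law_drop_cvg0 T eta : 0 < T -> 0 < eta ->
  law (T / n.+1%:R) (drop_set (eta * (T / n.+1%:R)) (T / n.+1%:R)) @[n --> \oo] --> (0 : R).
Proof.
move=> T0 eta0; pose h n : R := T / n.+1%:R.
have h0 n : 0 < h n by rewrite divr_gt0.
pose E n i := [set w | drop_set (eta * h n) (h n) (X (i.+1%:R * h n) w - X (i%:R * h n) w)].
have mE n i : measurable (E n i).
  by apply: measurable_increment; [exact: measurable_drop|..]; rewrite mulr_ge0// ltW.
pose f n w : \bar R := ((\sum_(i < n.+1) \1_(E n i) w) / n.+1%:R)%:E.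
have mf n : measurable_fun setT (f n).
  apply/measurable_EFinP; apply: measurable_funM => //.
  by apply: measurable_sum => i; exact: measurable_indic.
have fE n : (\int[P]_w f n w = (law (h n) (drop_set (eta * h n) (h n)))%:E)%E.
  rewrite /f; under eq_integral do rewrite mulrC EFinM.
  rewrite ge0_integralZl_EFin//.
  - rewrite integral_sum_indic// -EFinM; congr EFin.
    rewrite (eq_bigr (fun=> law (h n) (drop_set (eta * h n) (h n)))) => [|i _]; last first.
      by rewrite law_cell// ?ltW//; exact: measurable_drop.
    by rewrite sumr_const card_ord -[X in _ * X]mulr_natl mulKf.
  - by move=> w _; rewrite lee_fin; apply: sumr_ge0 => i _; exact: ler0n.
  - by apply/measurable_EFinP; apply: measurable_sum => i; exact: measurable_indic.
have [] := @dominated_convergence _ _ _ P setT measurableT f (cst 0%E) (cst 1%E) mf.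
- exact: measurable_cst.
- apply: filterS hS => w pj _.
  apply/fine_cvgP; split; first exact: nearW.
  apply/cvgrPdist_le => /= e e0.
  (* With this d, the term d / (eta h) is e / 2 times the number of cells; the other half absorbs K
     once n is large. *)
  have [K HK] := @pure_jump_count _ _ _ T (e * (eta * T) / 2) eta pj (ltW T0)
    ltac:(by rewrite divr_gt0// !mulr_gt0//) eta0.
  near=> n; rewrite sub0r normrN ger0_norm; last first.
    by apply: divr_ge0 => //; apply: sumr_ge0 => i _; exact: ler0n.
  have nz : n.+1%:R != 0 :> R by rewrite pnatr_eq0.
  have := HK n.+1 (h n) (h0 n) ltac:(by rewrite /h mulrCA mulfV// mulr1).
  rewrite ler_pdivrMr ?ltr0n// => H.
  rewrite (eq_bigr (fun i : 'I_n.+1 =>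
    (eta * h n < S w (i.+1%:R * h n) - S w (i%:R * h n))%R%:R)); last first.
    move=> i _; rewrite -(indic_bool (fun w =>
      eta * h n < S w (i.+1%:R * h n) - S w (i%:R * h n))).
    congr (\1_ _ w).
    by apply/funext => w'; exact: dropE.
  apply: (le_trans H).
  have -> : e * (eta * T) / 2 / (eta * h n) = e * n.+1%:R / 2.
    by rewrite /h; field; rewrite nat1r nz !gt_eqF.
  suff : K <= e * n.+1%:R / 2 by lra.
  rewrite ler_pdivlMr// [leRHS]mulrC -ler_pdivrMr//.
  apply: (@le_trans _ _ n%:R); last by rewrite ler_nat.
  near: n; exact: nbhs_infty_ger.
- by apply: (finite_measure_integrable_cst P 1).
- apply: aeW => w n _; rewrite /f gee0_abs ?lee_fin; last first.
    by apply: divr_ge0 => //; apply: sumr_ge0 => i _; exact: ler0n.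
  rewrite ler_pdivrMr// mul1r -[leRHS]mulr1 mulr_natl -[in leRHS](card_ord n.+1) -sumr_const.
  by apply: ler_sum => i _; rewrite indicE; case: (_ \in _).
move=> _ _; rewrite integral0 /= => /fine_cvg.
by apply: cvg_trans; apply: near_eq_cvg; apply: nearW => n /=; rewrite fE.
Unshelve. all: by end_near. Qed.

End levy_increments.

(** * Growth probabilities on a grid and time spent near a level *)

Section levy_drops.
Context d (Omega : measurableType d) (R : realType) (P : probability Omega R).

(** The sets of points lying in all [U n] with n >= m increase with m; continuity from below passes
    the bound to their union, the lower limit of the events. *)
Lemma pr_liminf_le (U : nat -> set Omega) (k : R) : (forall n, measurable (U n)) ->
  (\forall n \near \oo, pr P (U n) <= k) ->
  pr P (\bigcup_m \bigcap_(n in [set n | (m <= n)%N]) U n) <= k.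
Proof.
move=> mU [N _ HN]; set F := fun m : nat => \bigcap_(n in [set n | (m <= n)%N]) U n.
have mF m : measurable (F m) by apply: bigcap_measurableType => i _.
have mFu : measurable (\bigcup_m F m) by apply: bigcupT_measurable.
have /(_ mF mFu) H := @nondecreasing_cvg_mu _ _ _ P F.
rewrite -lee_fin -prE//.
apply: (cvge_to_le (H _)).
- move=> m n mn; apply/subsetPset => w Fw i /= ni; apply: Fw => /=.
  exact: leq_trans mn ni.
- near=> m; rewrite /= prE// lee_fin; apply: le_trans (HN (maxn m N) _); last first.
    by rewrite /= leq_maxr.
  by apply: pr_ae_le => //; apply: aeW => w; apply; rewrite /= leq_maxl.
Unshelve. all: by end_near. Qed.

Lemma pr_bigcup_le (n : nat) (E : nat -> set Omega) : (forall i, measurable (E i)) ->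
  pr P (\bigcup_(i in `I_n) E i) <= \sum_(i < n) pr P (E i).
Proof.
move=> mE; rewrite -lee_fin -sumEFin -prE; last exact: bigcup_measurable.
rewrite bigcup_mkord; apply: (le_trans (Boole_inequality _ _)) => //.
by apply: lee_sum => i _; rewrite -prE.
Qed.

Lemma increments_le (f : R -> R) (h k : R) n :
  (forall i, (i < n)%N -> f (i.+1%:R * h) - f (i%:R * h) <= k) ->
  f (n%:R * h) - f 0 <= n%:R * k.
Proof.
elim: n => [|n IH] H; first by rewrite !mul0r subrr.
have := IH (fun i ni => H i (ltnW ni)); have := H n (ltnSn n).
have -> : n.+1%:R * k = n%:R * k + k by rewrite -natr1 mulrDl mul1r.
lra.
Qed.

Lemma increments_ge (f : R -> R) (h k : R) n :
  (forall i, (i < n)%N -> k <= f (i.+1%:R * h) - f (i%:R * h)) ->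
  n%:R * k <= f (n%:R * h) - f 0.
Proof.
move=> H; have := @increments_le (\- f) h (- k) n.
rewrite mulrN /= => K; have := K (fun i ni => ltac:(by have := H i ni; rewrite /=; lra)).
lra.
Qed.

(** Induction from (1 - p) (1 + (n + 1) p) = 1 + n p - (n + 1) p^2 <= 1 + n p. *)
Lemma one_sub_expr_le (p : R) n : 0 <= p <= 1 -> (1 - p) ^+ n * (1 + n%:R * p) <= 1.
Proof.
move=> /andP[p0 p1]; elim: n => [|n IH]; first by rewrite expr0; lra.
apply: le_trans IH; rewrite exprSr -mulrA ler_wpM2l ?exprn_ge0 ?subr_ge0//.
rewrite -natr1; have : 0 <= n%:R * p * p by rewrite !mulr_ge0.
have : 0 <= p * p by exact: mulr_ge0.
lra.
Qed.

Variables (X : R -> Omega -> R) (hX : levy_process P X).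
Variables (g : R) (c : Omega -> R -> R).
Hypothesis g0 : 0 < g.
Hypothesis hS : {ae P, forall w, pure_jump (c w) (fun t => g * t - X t w)}.

Local Notation law := (law P X).
Local Notation drop := (drop_set g).
Let mdrop := @measurable_drop R g.

Lemma pr_grid0 h n B : 0 <= h -> measurable B ->
  pr P (\bigcap_(i in `I_n)
     [set w | B (X (i.+1%:R * h) w - X (i%:R * h) w)]) = law h B ^+ n.
Proof.
move=> h0 mB; rewrite -(pr_grid hX n (lexx 0) h0 mB); congr (pr _ _).
by apply: eq_bigcapr => i _; rewrite !add0r.
Qed.

Lemma lawC h B : 0 <= h -> measurable B -> law h (~` B) = 1 - law h B.
Proof. by move=> h0 mB; rewrite -prC//; exact: (measurable_increment hX). Qed.

Lemma measurable_cell h i B : 0 <= h -> measurable B ->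
  measurable [set w | B (X (i.+1%:R * h) w - X (i%:R * h) w)].
Proof. by move=> h0 mB; apply: (measurable_increment hX) => //; rewrite mulr_ge0. Qed.

(** On a fine grid a cell has growth above eta / T times its length with probability below 1. By
    independence all cells avoid this together with positive probability, and the growths then add
    up to at most eta. *)
Lemma pr_small_drop T eta : 0 < T -> 0 < eta ->
  0 < pr P [set w | g * T - (X T w - X 0 w) <= eta].
Proof.
move=> T0 eta0; have /cvgrPdist_lt /(_ 1 ltr01) := law_drop_cvg0 hX hS T0 (divr_gt0 eta0 T0).
move=> [n _ /(_ n (leqnn n))] /=; set h := T / n.+1%:R.
have nz : n.+1%:R != 0 :> R by rewrite pnatr_eq0.
have h0 : 0 < h by rewrite divr_gt0.
have nh : n.+1%:R * h = T by rewrite /h mulrCA mulfV// mulr1.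
rewrite sub0r normrN => /ltr_normlW p1.
set B := drop (eta / T * h) h.
have mB : measurable B := mdrop _ _.
apply: (@lt_le_trans _ _ (law h (~` B) ^+ n.+1)).
  by rewrite exprn_gt0// lawC ?(ltW h0)// subr_gt0.
rewrite -pr_grid0 ?(ltW h0)//; last exact: measurableC.
apply: pr_ae_le.
- by apply: bigcap_measurableType => i _; apply: measurable_cell; [exact: ltW|exact: measurableC].
- rewrite (_ : [set w | _] = [set w | (~` drop eta T) (X T w - X 0 w)]); last first.
    by apply/seteqP; split => w /=; rewrite /drop_set /=; lra.
  by apply: (measurable_increment hX); [exact: measurableC| |exact: ltW].
apply: aeW => w Hw /=; have := @increments_le (fun t => g * t - X t w) h (eta / T * h) n.+1.
have -> : n.+1%:R * (eta / T * h) = eta by rewrite mulrCA nh divfK// gt_eqF.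
rewrite nh => K.
suff : g * T - X T w - (g * 0 - X 0 w) <= eta by lra.
apply: K => i ni; have /= := Hw i ni; rewrite /B /drop_set /= -natr1 mulrDl mul1r; lra.
Qed.

(* (1 - p)^n is at least the positive probability that S T <= e, while
   (1 - p)^n (1 + n p) <= 1. *)
Lemma law_drop_le T e : 0 < T -> 0 < e -> exists2 C, 0 < C &
  forall n h, 0 < h -> n%:R * h = T -> n%:R * law h (drop e h) <= C.
Proof.
move=> T0 e0; have q0 := pr_small_drop T0 e0.
set q := pr P _ in q0; exists q^-1; first by rewrite invr_gt0.
move=> n h h0 nh; set p := law h _.
have mB := mdrop e h; have hh := ltW h0.
have p01 : 0 <= p <= 1.
  by rewrite pr_ge0 pr_le1//; exact: (measurable_increment hX).
have qp : q <= (1 - p) ^+ n.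
  rewrite -lawC// -pr_grid0//; last exact: measurableC.
  apply: pr_ae_le.
  - rewrite (_ : [set w | _] = [set w | (~` drop e T) (X T w - X 0 w)]); last first.
      by apply/seteqP; split => w /=; rewrite /drop_set /=; lra.
    by apply: (measurable_increment hX); [exact: measurableC| |exact: ltW].
  - by apply: bigcap_measurableType => i _; apply: measurable_cell; [|exact: measurableC].
  (* S is nondecreasing, so a growth of at most e up to T bounds the growth on every cell. *)
  apply: filterS hS => w pj /= ST i /= ni; apply/negP; rewrite -leNgt.
  have iE : i.+1%:R * h = i%:R * h + h by rewrite -natr1 mulrDl mul1r.
  have i0 : 0 <= i%:R * h by rewrite mulr_ge0.
  have ii : i%:R * h <= i.+1%:R * h by rewrite ler_wpM2r// ler_nat.
  have iT : i.+1%:R * h <= T by rewrite -nh ler_wpM2r// ler_nat.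
  have := pure_jump_mono pj (lexx 0) i0.
  have := pure_jump_mono pj (le_trans i0 ii) iT.
  move: ST; rewrite /= !iE; lra.
rewrite -(ler_pM2r q0) mulVf ?gt_eqF//.
have np : 0 <= n%:R * p by rewrite mulr_ge0//; case/andP: p01.
apply: le_trans (one_sub_expr_le n p01).
have : n%:R * p * q <= n%:R * p * (1 - p) ^+ n by rewrite ler_wpM2l.
have : 0 <= (1 - p) ^+ n by apply: le_trans qp; exact: ltW.
lra.
Qed.

Definition near_level a e : set R := [set x : R | `|x - a| <= e].

Lemma measurable_near_level a e : measurable (near_level a e).
Proof.
rewrite (_ : near_level a e = [set` `[a - e, a + e]]); first exact: measurable_itv.
by apply/seteqP; split => x; rewrite /near_level /= in_itv /= ler_distl.
Qed.

(** Either S grows by more than eta h over the block, and all m times may be near a, or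
    [occupation_count] bounds the number of those that are. Expectations give the two terms. *)
Lemma law_near_block a u h e eta m : 0 < h -> 0 <= u -> 0 <= e -> 0 <= eta -> (0 < m)%N ->
  \sum_(i < m) law (u + i%:R * (h / m%:R)) (near_level a e) <=
  m%:R * law h (drop (eta * h) h) + (m%:R * ((2 * e + eta * h) / (g * h)) + 1).
Proof.
move=> h0 u0 e0 eta0 m0; have hh := ltW h0.
have mB := mdrop (eta * h) h; have mL := measurable_near_level a e.
have uh : 0 <= u + h by rewrite addr_ge0.
have hm i : 0 <= u + i%:R * (h / m%:R) by rewrite addr_ge0// mulr_ge0// divr_ge0.
have C0 : 0 <= m%:R * ((2 * e + eta * h) / (g * h)) + 1 :> R.
  have eh : 0 <= eta * h by apply: mulr_ge0.
  have gh : 0 <= (g * h)^-1 by rewrite invr_ge0; apply: mulr_ge0 => //; exact: ltW.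
  by apply: addr_ge0 => //; apply: mulr_ge0 => //; apply: mulr_ge0 => //; lra.
rewrite -(law_shift hX u0 hh mB).
apply: (@sum_pr_le _ _ _ P m
  (fun i => [set w | near_level a e (X (u + i%:R * (h / m%:R)) w - X 0 w)])) => //.
- by move=> i; exact: (measurable_increment hX).
- exact: (measurable_increment hX).
apply: filterS hS => w pj.
case: (boolP (eta * h < (g * (u + h) - X (u + h) w) - (g * u - X u w))) => Hd.
  rewrite [in leRHS]indicE mem_set /= ?mulr1; last by rewrite /drop_set /=; lra.
  rewrite -[leLHS]addr0 lerD//.
  rewrite -[leRHS]mulr1 mulr_natl -[in leRHS](card_ord m) -sumr_const.
  by apply: ler_sum => i _; rewrite indicE; case: (_ \in _).
rewrite -leNgt in Hd.
apply: (@le_trans _ _ (m%:R * ((2 * e + eta * h) / (g * h)) + 1)); last first.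
  by rewrite lerDr mulr_ge0// indicE.
have := @occupation_count R (fun t => X t w - X 0 w) g a u h e eta m g0 h0 u0 e0 eta0 m0.
move=> H; apply: le_trans (H _ _); last 2 first.
- by move=> x y x0 xy; have := pure_jump_mono pj x0 xy; rewrite /=; lra.
- by move: Hd; rewrite /=; lra.
by apply: ler_sum => i _; rewrite -(indic_bool R (fun w =>
  `|X (u + i%:R * (h / m%:R)) w - X 0 w - a| <= e)).
Qed.

(** The grid is cut into b blocks of length h with m times each, and the block bound is summed. *)
Lemma law_near_sum a h e eta b m : 0 < h -> 0 <= e -> 0 <= eta -> (0 < m)%N ->
  \sum_(i < b * m) law (i%:R * (h / m%:R)) (near_level a e) <=
  b%:R * (m%:R * law h (drop (eta * h) h) + (m%:R * ((2 * e + eta * h) / (g * h)) + 1)).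
Proof.
move=> h0 e0 eta0 m0.
rewrite -(big_mkord xpredT (fun i => law (i%:R * (h / m%:R)) (near_level a e))).
rewrite big_nat_mul big_mkord -[in leRHS](card_ord b) mulr_natl -sumr_const.
apply: ler_sum => k _.
rewrite mulSn -{1}[(k * m)%N]add0n big_addn addnK big_mkord.
apply: le_trans (law_near_block a h0 (u := k%:R * h) _ e0 eta0 m0); last first.
  by rewrite mulr_ge0// ltW.
rewrite le_eqVlt; apply/orP; left; apply/eqP; apply: eq_bigr => i _.
rewrite (_ : (i + k * m)%:R * (h / m%:R) = k%:R * h + i%:R * (h / m%:R))//.
by rewrite natrD natrM addrC mulrDl -[in LHS]mulrA [m%:R * _]mulrC divfK// pnatr_eq0 -lt0n.
Qed.

End levy_drops.

(** * Jumps from a fixed level *)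

Section no_creeping_jump.
Context d (Omega : measurableType d) (R : realType) (P : probability Omega R).
Variables (X : R -> Omega -> R) (hX : levy_process P X).
Variables (g : R) (c : Omega -> R -> R).
Hypothesis g0 : 0 < g.
Hypothesis hS : {ae P, forall w, pure_jump (c w) (fun t => g * t - X t w)}.

Local Notation drop := (drop_set g).
Local Notation law := (law P X).
Let mdrop := @measurable_drop R g.

Let hit a e k n (h : R) := \bigcup_(i in `I_n)
  ([set w | near_level a e (X (i%:R * h) w - X 0 w)] `&`
   [set w | drop k h (X (i%:R * h + h) w - X (i%:R * h) w)]).

Let measurable_hit a e k n h : 0 <= h -> measurable (hit a e k n h).
Proof.
move=> h0; apply: bigcup_measurable => i _.
have ih : 0 <= i%:R * h by rewrite mulr_ge0.
apply: measurableI; apply: (measurable_increment hX) => //; first exact: measurable_near_level.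
by rewrite addr_ge0.
Qed.

(** The position at a grid time is independent of the growth on the next cell, so the union bound is
    a sum of products. The first factors add up to a small fraction of b m, and the second is at
    most C / (b m). The number b of blocks is fixed before m grows. *)
Let pr_hit_le a T k kappa : 0 < T -> 0 < k -> 0 < kappa ->
  exists e b, [/\ 0 < e, (0 < b)%N & \forall m \near \oo,
    (0 < m)%N -> pr P (hit a e k (b * m) (T / (b * m)%:R)) <= kappa].
Proof.
move=> T0 k0 ka0; have [C C0 HC] := law_drop_le hX hS T0 k0.
(* The final bound is C times three terms, each made at most ka: the growth probability of a block,
   the time spent near a, and 1 / m. *)
set ka := kappa / (3 * C); have ka1 : 0 < ka by rewrite divr_gt0// mulr_gt0.
(* Chosen so that, with tolerance eta h around a, (2 eta h + eta h) / (g h) equals ka. *)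
set eta := ka * g / 3; have eta0 : 0 < eta by rewrite divr_gt0// mulr_gt0.
have /cvgrPdist_le /(_ ka ka1) [b' _ /(_ b' (leqnn b'))] := law_drop_cvg0 hX hS T0 eta0.
rewrite /= sub0r normrN; set b := b'.+1; set h := T / b%:R => /ler_normlW pka.
have b0 : 0 < b%:R :> R by rewrite ltr0n.
have h0 : 0 < h by rewrite divr_gt0.
exists (eta * h), b; split => //; first exact: mulr_gt0.
near=> m => m0; have m0' : 0 < m%:R :> R by rewrite ltr0n.
set h' := T / (b * m)%:R.
have h'E : h' = h / m%:R by rewrite /h' /h natrM invfM mulrA.
have h'0 : 0 < h' by rewrite h'E divr_gt0.
have bm0 : 0 < (b * m)%:R :> R by rewrite natrM mulr_gt0.
have mL := measurable_near_level a (eta * h).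
have mD := mdrop k h'.
apply: (le_trans (pr_bigcup_le _ _ _)) => [i|].
  have ih : 0 <= i%:R * h' by rewrite mulr_ge0// ltW.
  by apply: measurableI; apply: (measurable_increment hX) => //; rewrite addr_ge0// ltW.
rewrite (eq_bigr (fun i : 'I_(b * m) =>
  law (i%:R * (h / m%:R)) (near_level a (eta * h)) * law h' (drop k h'))); last first.
  move=> i _; rewrite -h'E (pr_two hX) ?(ltW h'0)//.
  by rewrite mulr_ge0// ltW.
rewrite -mulr_suml.
have := law_near_sum hX g0 hS a b h0 (ltW (mulr_gt0 eta0 h0)) (ltW eta0) m0.
set s := \sum_(i < b * m) _ => hs.
have hq : law h' (drop k h') <= C / (b * m)%:R.
  rewrite ler_pdivlMr// mulrC; apply: HC => //.
  by rewrite /h' mulrCA mulfV ?mulr1// gt_eqF.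
have s0 : 0 <= s by apply: sumr_ge0 => i _; exact: law_ge0.
apply: le_trans (ler_wpM2l s0 hq) _.
apply: le_trans (ler_wpM2r _ hs) _; first by rewrite divr_ge0// ltW.
have -> : (2 * (eta * h) + eta * h) / (g * h) = ka.
  by rewrite /eta; field; rewrite !gt_eqF.
have -> : kappa = C * (ka + ka + ka).
  by rewrite /ka; field; rewrite gt_eqF.
have -> : b%:R * (m%:R * law h (drop (eta * h) h) + (m%:R * ka + 1)) * (C / (b * m)%:R) =
   C * (law h (drop (eta * h) h) + ka + m%:R^-1).
  by rewrite natrM; field; rewrite !gt_eqF.
rewrite ler_pM2l//; suff : m%:R^-1 <= ka by move: pka; lra.
rewrite invf_ple ?posrE//; near: m; exact: nbhs_infty_ger.
Unshelve. all: by end_near. Qed.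

(** Almost surely a path with such a jump lies in [hit] for every fine enough grid, hence in a lower
    limit of events of probability at most kappa, with kappa arbitrary. *)
Let negligible_jump_from_level_bounded a T e : 0 < T -> 0 < e ->
  P.-negligible [set w | exists s, [/\ 0 < s <= T,
     lim (X x w @[x --> s^'-]) = a & X s w <= a - e]].
Proof.
move=> T0 e0; apply: negligible_small => kappa ka0.
(* The threshold is e / 4: the jump makes S grow by at least e / 2 on its cell, and [drop] needs a
   strict inequality. *)
have [d0 [b [d00 b0 H]]] := pr_hit_le a T0 (divr_gt0 e0 (ltr0n _ 4 : 0 < 4)) ka0.
pose h m : R := T / (b * m.+1)%:R.
have bm0 m : 0 < (b * m.+1)%:R :> R by rewrite ltr0n muln_gt0 b0.
have h0 m : 0 < h m by rewrite divr_gt0.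
pose U m := hit a d0 (e / 4) (b * m.+1) (h m).
have mU m : measurable (U m) by apply: measurable_hit; exact: ltW.
exists (\bigcup_m \bigcap_(n in [set n | (m <= n)%N]) U n); split.
- apply: bigcupT_measurable => m; exact: bigcap_measurableType.
- apply: pr_liminf_le => //; case: H => N _ HN; exists N => // m /= Nm.
  by apply: HN => //=; exact: leq_trans Nm _.
apply: negligibleS hS => w [[s [/andP[s0 sT] La Xs]] nU] /= pj; apply: nU.
have X0 : X 0 w = 0 by have := pure_jump0 pj; lra.
have [r r0 Hr] := left_limit_increment (levy_cadlag hX w) s0 g0
  (fun x y => @pure_jump_mono _ _ _ x y pj) La Xs e0 d00.
have [N _ HN] : \forall m \near \oo, h m < r.
  near=> m; rewrite /h ltr_pdivrMr// mulrC -ltr_pdivrMr//.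
  apply: (@lt_le_trans _ _ m%:R); first by near: m; exact: nbhs_infty_gtr.
  by rewrite ler_nat (leq_trans (leqnSn m))// leq_pmull.
exists N => // m /= /HN /= hm.
have [|i ib /andP[is1 is2]] := @exists_cell _ (h m) (b * m.+1) s (h0 m) s0.
  by rewrite /h mulrCA mulfV ?mulr1// gt_eqF.
have iE : i.+1%:R * h m = i%:R * h m + h m by rewrite -natr1 mulrDl mul1r.
exists i => //; rewrite /= X0 subr0 -iE.
have [] := Hr (i%:R * h m) (i.+1%:R * h m).
- by rewrite mulr_ge0// ltW.
- by rewrite is1 is2.
- by rewrite iE; lra.
move=> L1 L2; split => //; rewrite /drop_set /=; move: L2; rewrite iE; lra.
Unshelve. all: by end_near. Qed.

Lemma ae_no_jump_from_level a :
  {ae P, forall w, forall s, 0 < s -> lim (X x w @[x --> s^'-]) = a -> a <= X s w}.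
Proof.
pose N k := [set w | exists s, [/\ 0 < s <= k.+1%:R,
     lim (X x w @[x --> s^'-]) = a & X s w <= a - k.+1%:R^-1]].
have : P.-negligible (\bigcup_k N k).
  by apply: negligible_bigcup => k; apply: negligible_jump_from_level_bounded; rewrite ?invr_gt0.
apply: negligibleS => w /=; apply: contra_notP => nN s s0 La.
rewrite leNgt; apply/negP => Xa; apply: nN.
set k := Num.truncn (Num.max s (a - X s w)^-1).
have : Num.max s (a - X s w)^-1 < k.+1%:R by exact: truncnS_gt.
rewrite gt_max => /andP[sk ak]; exists k => //; exists s; split => //.
  by rewrite s0 ltW.
rewrite lerBrDr addrC -lerBrDr ltW//.
by rewrite invf_plt ?posrE// subr_gt0.
Qed.

End no_creeping_jump.

(** * Positive probability of large drops in a short time *)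

Section large_drops.
Context d (Omega : measurableType d) (R : realType) (P : probability Omega R).
Variables (X : R -> Omega -> R) (hX : levy_process P X).
Variables (g : R) (c : Omega -> R -> R).
Hypothesis hS : {ae P, forall w, pure_jump (c w) (fun t => g * t - X t w)}.

Local Notation drop := (drop_set g).
Local Notation law := (law P X).
Let mdrop := @measurable_drop R g.

(** Otherwise each threshold 1 / (k + 1) has a grid of ]0, 1] on which almost surely no cell has
    such a growth. A jump larger than the threshold falls in some cell of that grid, so D would be
    covered by countably many null sets. *)
Lemma law_drop_gt0 D : measurable D -> 0 < pr P D ->
  (forall w, D w -> exists2 s, 0 < s <= 1 & 0 < c w s) ->
  exists2 e, 0 < e & forall n, 0 < law n.+1%:R^-1 (drop e n.+1%:R^-1).
Proof.
move=> mD D0 HD; apply: contrapT => H.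
have /choice[n Hn] k : exists n, law n.+1%:R^-1 (drop k.+1%:R^-1 n.+1%:R^-1) = 0.
  apply: contrapT => Hk; apply: H; exists k.+1%:R^-1; first by rewrite invr_gt0.
  move=> n; rewrite lt_neqAle law_ge0 andbT eq_sym; apply/eqP => n0.
  by apply: Hk; exists n.
pose h k : R := (n k).+1%:R^-1.
have h0 k : 0 < h k by rewrite invr_gt0.
pose N k := \bigcup_(i in `I_(n k).+1) [set w |
  drop k.+1%:R^-1 (h k) (X (i.+1%:R * h k) w - X (i%:R * h k) w)].
have : P.-negligible D.
  apply: (@negligibleS _ _ _ _ (\bigcup_k N k `|`
      ~` [set w | pure_jump (c w) (fun t => g * t - X t w)])).
    move=> w Dw; have [pj|] := pselect (pure_jump (c w) (fun t => g * t - X t w)); last by right.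
    left; have [s /andP[s0 s1] cs] := HD w Dw.
    set k := Num.truncn (c w s)^-1.
    have kc : k.+1%:R^-1 < c w s.
      by rewrite invf_plt ?posrE//; exact: truncnS_gt.
    exists k => //.
    have [|i ib is12] := @exists_cell _ (h k) (n k).+1 s (h0 k) s0.
      by rewrite /h mulfV.
    exists i => //; rewrite /= dropE; apply: (lt_le_trans kc).
    by apply: (pure_jump_ge pj) => //; rewrite mulr_ge0// ltW.
  apply: negligibleU; last exact: hS.
  apply: negligible_bigcup => k; apply: (@negligibleS _ _ _ _ (\bigcup_i [set w |
      drop k.+1%:R^-1 (h k) (X (i.+1%:R * h k) w - X (i%:R * h k) w)])).
    by move=> w [i _ ?]; exists i.
  apply: negligible_bigcup => i.
  have m : measurable [set w | drop k.+1%:R^-1 (h k) (X (i.+1%:R * h k) w - X (i%:R * h k) w)].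
    by apply: (measurable_cell hX); [exact: ltW|exact: mdrop].
  apply/negligibleP => //; apply: (etrans (prE _ m)); congr EFin.
  by rewrite (law_cell hX) ?(ltW (h0 k))//; exact: Hn.
move=> /pr_negligible /(_ mD) D00; by rewrite D00 ltxx in D0.
Qed.

Lemma pr_large_drop e t1 b : 0 < e ->
  (forall n, 0 < law n.+1%:R^-1 (drop e n.+1%:R^-1)) -> 0 < t1 ->
  exists t, 0 < t < t1 /\ 0 < pr P [set w | b <= g * t - (X t w - X 0 w)].
Proof.
(* K growths of size e add up to at least b, and n is so large that K cells of length 1 / (n + 1)
   last less than t1. *)
move=> e0 He t10; set K := (Num.truncn (b / e)).+1.
have Kb : b <= K%:R * e by rewrite -ler_pdivrMr// ltW// truncnS_gt.
set n := Num.truncn (K%:R / t1); set h : R := n.+1%:R^-1.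
have h0 : 0 < h by rewrite invr_gt0.
exists (K%:R * h); split.
  rewrite mulr_gt0//= /h ltr_pdivrMr// mulrC -ltr_pdivrMr//; exact: truncnS_gt.
have mB := mdrop e h.
apply: (@lt_le_trans _ _ (law h (drop e h) ^+ K)); first by apply: exprn_gt0; exact: He.
rewrite -(pr_grid0 hX) ?(ltW h0)//; apply: pr_ae_le.
- by apply: bigcap_measurableType => i _; apply: (measurable_cell hX); [exact: ltW|].
- rewrite (_ : [set w | _] = [set w |
      [set` `]-oo, (g * (K%:R * h) - b)]] (X (K%:R * h) w - X 0 w)]).
    by apply: (measurable_increment hX) => //; rewrite mulr_ge0// ltW.
  by apply/seteqP; split => w; rewrite /= in_itv /=; lra.
apply: aeW => w Hw /=; apply: le_trans Kb _.
have := @increments_ge _ (fun t => g * t - X t w) h e K.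
move=> Ki; have := Ki (fun i iK => ltac:(have /= := Hw i iK; rewrite dropE => /ltW; exact)).
by rewrite mulr0; lra.
Qed.

End large_drops.

(** * Almost sure absence of positive jumps *)

Section positive_jumps.
Context d (Omega : measurableType d) (R : realType) (P : probability Omega R).
Variables (X : R -> Omega -> R) (hX : levy_process P X).
(** Phrased with measurable events E, since the set of paths with a positive jump is not known to be
    measurable. *)
Hypothesis hpos : forall E, measurable E ->
  (forall w, E w -> exists2 s, 0 < s <= 1 & 0 < jump (X ^~ w) s) -> pr P E = 0.

Let up (e : R) : set R := [set x | e <= x].

Let measurable_up e : measurable (up e).
Proof.
rewrite (_ : up e = [set` `[e, +oo[]); first exact: measurable_itv.
by apply/seteqP; split => x; rewrite /up /= in_itv /= andbT.
Qed.

(* The probability of [rise e j n] does not depend on j: this carries the absence of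
   positive jumps from the time interval ]0, 1] to all times. *)
Let rise e (j n : nat) := ~` \bigcap_(i in `I_n.+1)
  [set w | (~` up e) (X (j%:R + i.+1%:R * n.+1%:R^-1) w - X (j%:R + i%:R * n.+1%:R^-1) w)].

Let measurable_rise e j n : measurable (rise e j n).
Proof.
apply: measurableC; apply: bigcap_measurableType => i _.
by apply: (measurable_increment hX); [exact: measurableC|rewrite addr_ge0 ?mulr_ge0..].
Qed.

Let pr_rise e j n : pr P (rise e j n) = pr P (rise e 0 n).
Proof.
rewrite /rise !prC; first 1 last.
- by rewrite -[X in measurable X]setCK; apply: measurableC; exact: measurable_rise.
- by rewrite -[X in measurable X]setCK; apply: measurableC; exact: measurable_rise.
by rewrite !(pr_grid hX)//; exact: measurableC.
Qed.

(** The upper limit of the events [rise] is measurable, and on it a positive jump occurs in ]0, 1]: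
    without one, increments over short times would all be below e. So it is null, and continuity
    from above concludes. *)
Let pr_rise_cvg0 e : 0 < e -> forall k, 0 < k -> \forall n \near \oo, pr P (rise e 0 n) <= k.
Proof.
move=> e0 k k0; pose F m := \bigcup_(n in [set n | (m <= n)%N]) rise e 0 n.
have mF m : measurable (F m) by apply: bigcup_measurable => n _; exact: measurable_rise.
have mI : measurable (\bigcap_m F m) by exact: bigcapT_measurable.
have I0 : pr P (\bigcap_m F m) = 0.
  apply: hpos => // w Fw; apply: contrapT => nj.
  have [r r0 Hr] := @no_jump_small_increments _ (X ^~ w) e (levy_cadlag hX w) e0
    (fun s s01 => ltac:(rewrite leNgt; apply/negP => js; apply: nj; exists s => //)).
  have [n /= nr] := Fw (Num.truncn r^-1) I.
  apply => i /= ni; apply/negP; rewrite -ltNge !add0r.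
  have n1 : n.+1%:R^-1 < r.
    rewrite invf_plt ?posrE//; apply: lt_le_trans (truncnS_gt _) _.
    by rewrite ler_nat.
  have iE : i.+1%:R * n.+1%:R^-1 = i%:R * n.+1%:R^-1 + n.+1%:R^-1 :> R
    by rewrite -natr1 mulrDl mul1r.
  have n0 : 0 < n.+1%:R^-1 :> R by rewrite invr_gt0.
  apply: Hr; rewrite ?iE.
  - by rewrite mulr_ge0// ltW.
  - by rewrite lerDl ltW.
  - by rewrite -iE ler_pdivrMr// mul1r ler_nat.
  - by rewrite ltrD2l.
have : (P \o F) n @[n --> \oo] --> P (\bigcap_m F m).
  apply: nonincreasing_cvg_mu => //.
    by rewrite ltey_eq fin_num_measure.
  move=> m n mn; apply/subsetPset => w [i /= ni ri]; exists i => //=.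
  exact: leq_trans mn ni.
rewrite prE// I0 => /fine_cvgP[_ /cvgrPdist_le /(_ k k0)].
apply: filterS => n /=; rewrite sub0r normrN => /ler_normlW; apply: le_trans.
apply: pr_ae_le => //; apply: aeW => w rw; exists n => //=.
Qed.

(** A jump larger than 1 / (k + 1) at a time of ]j, j + 1] produces a rise on all fine grids of that
    interval, and the lower limit of these events is null. *)
Lemma ae_no_positive_jump : {ae P, forall w, forall s, 0 < s -> jump (X ^~ w) s <= 0}.
Proof.
pose V k j := \bigcup_m \bigcap_(n in [set n | (m <= n)%N]) rise k.+1%:R^-1 j n.
have : P.-negligible (\bigcup_k \bigcup_j V k j).
  apply: negligible_bigcup => k; apply: negligible_bigcup => j.
  apply: negligible_small => e e0; exists (V k j); split.
  - by apply: bigcupT_measurable => m; exact: bigcap_measurableType.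
  - apply: pr_liminf_le => //; have := pr_rise_cvg0 (_ : 0 < k.+1%:R^-1) e0.
    rewrite invr_gt0 ltr0n => /(_ isT); apply: filterS => n /=.
    by rewrite (pr_rise _ j).
  - by rewrite setDv; exact: negligible_set0.
apply: negligibleS => w /=; apply: contra_notP => nV s s0.
rewrite leNgt; apply/negP => js; apply: nV.
set k := Num.truncn (jump (X ^~ w) s)^-1.
have kj : k.+1%:R^-1 < jump (X ^~ w) s.
  by rewrite invf_plt ?posrE//; exact: truncnS_gt.
exists k => //.
have [|j _ /andP[js1 js2]] := @exists_cell _ 1 (Num.truncn s).+1 s ltr01 s0.
  by rewrite mulr1 ltW// truncnS_gt.
rewrite !mulr1 in js1 js2.
exists j => //; have [r r0 Hr] := jump_increment (levy_cadlag hX w) s0 kj.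
have [N _ HN] : \forall n \near \oo, n.+1%:R^-1 < r := near_infty_natSinv_lt (PosNum r0).
exists N => // n /= /HN nr.
have n0 : 0 < n.+1%:R^-1 :> R by rewrite invr_gt0.
have [||i ni /andP[i1 i2]] := @exists_cell _ n.+1%:R^-1 n.+1 (s - j%:R) n0.
- by rewrite subr_gt0.
- by rewrite mulfV// lerBlDl natr1.
move=> Hi; apply: (Hi i ni) => /=.
apply: Hr; first by rewrite -ltrBrDl i1 -lerBlDl i2.
by rewrite -natr1 mulrDl mul1r addrA ltrD2l.
Qed.

End positive_jumps.

(** * First exit *)

Section first_exit.
Context (R : realType).
Implicit Types f : R -> R.

Lemma cadlagN f : cadlag f -> cadlag (\- f).
Proof.
move=> [fr fl]; split=> t t0; first exact: cvgN (fr t t0).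
by apply/cvg_ex; exists (- lim (f x @[x --> t^'-])); exact: cvgN (fl t t0).
Qed.

Lemma left_limN f t : cadlag f -> 0 < t ->
  lim ((\- f) x @[x --> t^'-]) = - lim (f x @[x --> t^'-]).
Proof. by move=> [_ fl] t0; apply: cvg_lim => //; exact: cvgN (fl t t0). Qed.

Lemma left_lim_le f t c : cadlag f -> 0 < t -> (forall s, 0 <= s < t -> f s <= c) ->
  lim (f x @[x --> t^'-]) <= c.
Proof.
move=> cf t0 H; rewrite leNgt; apply/negP; set L := lim _ => cL.
have [r r0 Hr] := @cadlag_left _ f t (L - c) cf t0 ltac:(lra).
have [s st] : exists s, Num.max 0 (t - r) < s < t.
  exists ((Num.max 0 (t - r) + t) / 2); rewrite midf_lt//; last by rewrite gt_max t0; lra.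
  by rewrite midf_lt// gt_max t0; lra.
have : 0 < s /\ t - r < s by move: st; rewrite gt_max => /andP[/andP[]].
move=> [s0 rs]; have st' : s < t by case/andP: st.
have := H s ltac:(lra); have := Hr s ltac:(lra).
by rewrite -/L ltr_distl => /andP[? ?]; lra.
Qed.

(** Only downward jumps are possible: by monotonicity f s >= f t - g (t - s) for s just before t. *)
Lemma left_lim_ge f t (g : R) : cadlag f -> 0 < g -> 0 < t ->
  (forall x y, 0 <= x -> x <= y -> g * x - f x <= g * y - f y) ->
  f t <= lim (f x @[x --> t^'-]).
Proof.
move=> cf g0 t0 mono; apply/ler_addgt0Pr => e e0.
have [r r0 Hr] := @cadlag_left _ f t (e / 2) cf t0 ltac:(lra).
set L := lim _ in Hr *.
set s := Num.max (t / 2) (Num.max (t - r / 2) (t - e / 2 / g)).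
have [s1 s2 s3] : [/\ t / 2 <= s, t - r / 2 <= s & t - e / 2 / g <= s].
  by rewrite /s !le_max !lexx !orbT.
have eg : 0 < e / 2 / g by rewrite !divr_gt0.
have st : s < t by rewrite /s !gt_max; lra.
have := mono s t ltac:(lra) (ltW st); have := Hr s ltac:(lra).
rewrite ltr_distl => /andP[? ?].
have : g * (t - s) <= e / 2 by rewrite mulrC -ler_pdivlMr//; lra.
lra.
Qed.

(** If f stays below c, its left limits are at most c, hence below c by hypothesis, and compactness
    leaves a gap 1 / (k + 1). A path that approached c and then jumped down could have supremum c
    and no gap. *)
Lemma not_reachP f c u : cadlag f -> 0 <= u ->
  (forall s, 0 < s -> f s < c -> lim (f x @[x --> s^'-]) <= c ->
     lim (f x @[x --> s^'-]) < c) ->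
  (~ exists t, 0 <= t <= u /\ c <= f t) <->
  exists k, f u <= c - k.+1%:R^-1 /\
    forall q : rat, 0 <= (ratr q : R) <= u -> f (ratr q) <= c - k.+1%:R^-1.
Proof.
move=> cf u0 Hc; split.
  move=> nr; have fc t : 0 <= t <= u -> f t < c.
    by move=> tu; rewrite ltNge; apply/negP => ct; apply: nr; exists t.
  have [e e0 He] : exists2 e, 0 < e & forall s, 0 <= s <= u -> f s <= c - e.
    apply: cadlag_lt_sup => // s su; have fs := fc s ltac:(lra).
    apply: Hc => //; first by case/andP: su.
    apply: left_lim_le => //; first by case/andP: su.
    by move=> t ts; apply/ltW/fc; lra.
  set k := Num.truncn e^-1; have ke : k.+1%:R^-1 < e.
    by rewrite invf_plt ?posrE//; exact: truncnS_gt.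
  exists k; split; first by apply: le_trans (He u _) _; rewrite ?u0 ?lexx// lerB// ltW.
  by move=> q qu; apply: le_trans (He _ qu) _; rewrite lerB// ltW.
move=> [k [fu Hq]] [t [tu ct]].
have := cadlag_rat_le cf u0 fu Hq tu.
have : 0 < k.+1%:R^-1 :> R by rewrite invr_gt0.
by move: (k.+1%:R^-1) => e; lra.
Qed.

(** The interval is open and f right-continuous, so the infimum of the exit times is itself one. *)
Lemma exit_attained f (a b : R) t : cadlag f -> 0 <= t -> ~ (- b < f t < a) ->
  exists2 tau, ereal_inf (EFin @` [set t | 0 <= t /\ ~ (- b < f t < a)]) = tau%:E &
    [/\ 0 <= tau <= t, ~ (- b < f tau < a) &
      forall s, 0 <= s < tau -> - b < f s < a].
Proof.
move=> cf t0 ft; set Z := [set t | _].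
have Zt : Z t by [].
have lbZ : has_lbound Z by exists 0 => s [].
have iZ : has_inf Z by split => //; exists t.
have tau0 : 0 <= inf Z by apply: lb_le_inf; [exists t|move=> s []].
have Zinf : Z (inf Z).
  split => // ntau.
  have [r r0 Hr] := @cadlag_right _ f (inf Z)
    (Num.min (f (inf Z) + b) (a - f (inf Z))) cf tau0 ltac:(by rewrite lt_min; lra).
  have [s [s0 Zs] sr] := inf_adherent r0 iZ.
  have is_ : inf Z <= s := ge_inf lbZ (conj s0 Zs).
  apply: Zs; have := Hr s ltac:(lra).
  by rewrite lt_min !ltr_distl; lra.
exists (inf Z).
  apply/eqP; rewrite eq_le; apply/andP; split.
    by apply: ereal_inf_lbound; exists (inf Z).
  rewrite leNgt; apply/negP => /ereal_inf_lt[_ [s Zs <-]].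
  by rewrite lte_fin ltNge ge_inf.
split; first by rewrite tau0 ge_inf.
  by case: Zinf.
move=> s /andP[s0 sZ]; apply: contrapT => ns.
have := @ge_inf _ Z lbZ s; rewrite leNgt sZ => /(_ (conj s0 ns)).
by [].
Qed.

(** After an exit through a, right continuity keeps f above - b for a while, which leaves room for a
    rational q. Conversely, if a is reached by time q and - b is not, the first exit is through
    a. *)
Lemma exit_upP f (a b : R) (M : \bar R) : cadlag f -> 0 < a -> 0 < b ->
  (let T := ereal_inf (EFin @` [set t | 0 <= t /\ ~ (- b < f t < a)]) in
   [/\ (T < +oo)%E, a <= f (fine T) & 0 <= fine T /\ ((fine T)%:E < M)%E]) <->
  exists q : rat, [/\ 0 <= (ratr q : R), ((ratr q : R)%:E < M)%E,
    exists t, 0 <= t <= (ratr q : R) /\ a <= f t &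
    ~ exists t, 0 <= t <= (ratr q : R) /\ b <= - f t].
Proof.
move=> cf a0 b0 /=; split.
  move=> [] /ereal_inf_lt[_ [t [t0 ft] <-] _].
  have [tau -> [taut _ Hs]] := exit_attained cf t0 ft; rewrite /= => fa [tau0 tauM].
  have [m taum mM] : exists2 m : R, tau < m & (m%:E <= M)%E.
    case: M tauM => [m|_|//]; first by rewrite lte_fin => ?; exists m.
    by exists (tau + 1); [rewrite ltrDl|rewrite leey].
  have [r r0 Hr] := @cadlag_right _ f tau (f tau + b) cf tau0 ltac:(lra).
  have [q] := @rat_in_itvoo R tau (Num.min m (tau + r)) ltac:(by rewrite lt_min taum; lra).
  rewrite in_itv/= lt_min => /andP[tauq /andP[qm qr]]; exists q; split.
  - by apply: le_trans tau0 (ltW tauq).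
  - by apply: lt_le_trans mM; rewrite lte_fin.
  - by exists tau; rewrite tau0 ltW.
  - move=> [s [/andP[s0 sq] fs]]; have [st|st] := ltP s tau.
      by have := Hs s ltac:(lra); lra.
    by have := Hr s ltac:(lra); rewrite ltr_distl; lra.
move=> [q [q0 qM [t [/andP[t0 tq] fa]] nb]].
have [|tau -> [taut ftau _]] := @exit_attained f a b t cf t0; first by lra.
split; rewrite /=.
- exact: ltry.
- rewrite leNgt; apply/negP => fl; apply: nb; exists tau; split; first lra.
  by rewrite leNgt; apply/negP => bl; apply: ftau; lra.
- split; first lra.
  by apply: le_lt_trans qM; rewrite lee_fin; lra.
Qed.

End first_exit.

(** * Measurability of the exit events *)

Section exit_event.
Import HBNNSimple.
Context d (Omega : measurableType d) (R : realType) (P : probability Omega R).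

(* The event that Y reaches the level c before time u, written with countably many
   times; by [not_reachP] this is correct on paths whose left limits do not touch
   c from below just before a jump. *)
Definition reach (Y : R -> Omega -> R) (c u : R) : set Omega :=
  ~` \bigcup_k ([set w | Y u w <= c - k.+1%:R^-1] `&`
    \bigcap_(q : rat) [set w | 0 <= (ratr q : R) <= u ->
                               Y (ratr q) w <= c - k.+1%:R^-1]).

Lemma measurable_le_event (Y : R -> Omega -> R) t (c : R) : measurable_fun setT (Y t) ->
  measurable [set w | Y t w <= c].
Proof.
move=> mY; rewrite -[X in measurable X]setTI.
rewrite (_ : [set w | _] = Y t @^-1` [set` `]-oo, c]]); first exact: mY.
by apply/seteqP; split => w /=; rewrite in_itv.
Qed.

Lemma measurable_reach Y c u : (forall t, 0 <= t -> measurable_fun setT (Y t)) ->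
  0 <= u -> measurable (reach Y c u).
Proof.
move=> mY u0; apply/measurableC/bigcupT_measurable => k; apply: measurableI.
  by apply: measurable_le_event; exact: mY.
rewrite -[X in measurable X]setCK setC_bigcap; apply: measurableC.
apply: bigcupT_measurable_rat => q; apply: measurableC.
case: (boolP (0 <= (ratr q : R) <= u)) => qu.
  rewrite (_ : [set w | _] = [set w | Y (ratr q) w <= c - k.+1%:R^-1]).
    by apply: measurable_le_event; apply: mY; case/andP: qu.
  by apply/seteqP; split => w /=; [apply|move=> ? _].
by rewrite (_ : [set w | _] = setT)//; apply/seteqP; split.
Qed.

Definition exit_up Y (a b : R) (M : \bar R) : set Omega :=
  \bigcup_(q : rat) (if (0 <= (ratr q : R)) && ((ratr q : R)%:E < M)%E
    then reach Y a (ratr q) `\` reach (fun t => \- Y t) b (ratr q) else set0).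

Lemma measurable_exit_up Y a b M : (forall t, 0 <= t -> measurable_fun setT (Y t)) ->
  measurable (exit_up Y a b M).
Proof.
move=> mY; apply: bigcupT_measurable_rat => q; case: ifPn => // /andP[q0 _].
apply: measurableD; apply: measurable_reach => // t t0.
by apply: measurable_funN; exact: mY.
Qed.

(** Applied to X for the exit through a, and to - X with a and b exchanged for the exit through -
    b. *)
Lemma exit_upE Y a b M w : cadlag (Y ^~ w) -> 0 < a -> 0 < b ->
  (forall s, 0 < s -> Y s w < a -> lim (Y x w @[x --> s^'-]) <= a ->
     lim (Y x w @[x --> s^'-]) < a) ->
  (forall s, 0 < s -> - Y s w < b -> - lim (Y x w @[x --> s^'-]) <= b ->
     - lim (Y x w @[x --> s^'-]) < b) ->
  (let T := exit_time Y a b w in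
   [/\ (T < +oo)%E, a <= Y (fine T) w & 0 <= fine T /\ ((fine T)%:E < M)%E]) <->
  exit_up Y a b M w.
Proof.
move=> cY a0 b0 Ha Hb; apply: iff_trans (exit_upP M cY a0 b0) _.
have Ra u : 0 <= u -> reach Y a u w <-> exists t, 0 <= t <= u /\ a <= Y t w.
  move=> u0; have := not_reachP cY u0 Ha.
  move=> [H1 H2]; split.
    move=> nr; apply: contrapT => /H1[k [k1 k2]]; apply: nr.
    by exists k => //; split => // q _; exact: k2.
  move=> r [k _ [k1 k2]]; apply: H2 r.
  by exists k; split => // q; exact: k2.
have Rb u : 0 <= u -> reach (fun t => \- Y t) b u w <-> exists t, 0 <= t <= u /\ b <= - Y t w.
  move=> u0; have := @not_reachP _ (\- (Y ^~ w)) b u (cadlagN cY) u0.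
  have Hb' s : 0 < s -> (\- (Y ^~ w)) s < b -> lim ((\- (Y ^~ w)) x @[x --> s^'-]) <= b ->
     lim ((\- (Y ^~ w)) x @[x --> s^'-]) < b.
    by move=> s0; rewrite left_limN//; exact: Hb.
  move=> /(_ Hb') [H1 H2]; split.
    move=> nr; apply: contrapT => /H1[k [k1 k2]]; apply: nr.
    by exists k => //; split => // q _; exact: k2.
  move=> r [k _ [k1 k2]]; apply: H2 r.
  by exists k; split => // q; exact: k2.
split.
  move=> [q [q0 qM /Ra Hr nr]]; exists q => //; rewrite q0 qM; split; first exact: Hr.
  by move=> /Rb; apply: contra_not nr; apply.
move=> [q _]; case: ifPn => // /andP[q0 qM] [ra rb]; exists q; split => //.
  exact/Ra.
by move=> /Rb => H; apply: rb; exact: H.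
Qed.

(** The exit events agree with their countable descriptions only almost surely; completeness of [P]
    makes them measurable. *)
Lemma complete_measurable A A' : measure_is_complete P -> measurable A' ->
  {ae P, forall w, A w <-> A' w} -> measurable A.
Proof.
move=> cP mA' [N [mN N0 HN]].
have H w : ~ N w -> (A w <-> A' w) by move=> nN; apply: contrapT => h; apply: nN; exact: HN.
rewrite (_ : A = (A' `\` N) `|` (A `&` N)).
  apply: measurableU; first exact: measurableD.
  by apply: cP; exists N; split => // w [].
apply/seteqP; split => w.
  by move=> Aw; have [Nw|nN] := pselect (N w); [right|left; split => //; exact/H].
by move=> [[Aw nN]|[]]//; exact/H.
Qed.

(* In the next two lemmas f need not be measurable: the integral of a nonnegative
   function is a supremum over the simple functions below it. *)
Lemma lower_integral_gt0 (f : Omega -> \bar R) : (forall w, 0 <= f w)%E ->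
  (0 < \int[P]_w f w)%E ->
  exists D, [/\ measurable D, 0 < pr P D & forall w, D w -> (0 < f w)%E].
Proof.
move=> f0; rewrite ge0_integralTE// => /ereal_sup_gt[_ [h hf <-] h0].
exists [set w | 0 < h w].
have mD : measurable [set w | 0 < h w].
  rewrite (_ : [set w | _] = h @^-1` [set` `]0, +oo[]).
    by rewrite -[X in measurable X]setTI; exact: measurable_funP.
  by apply/seteqP; split => w /=; rewrite in_itv /= andbT.
split => //.
  rewrite lt_neqAle pr_ge0 andbT eq_sym; apply/eqP => D0.
  move: h0; rewrite -integralT_nnsfun (ae_eq_integral (cst 0%E)) ?integral0 ?ltxx//.
    by apply/measurable_EFinP; exact: measurable_funP.
  exists [set w | 0 < h w]; split => //; first by apply: (etrans (prE P mD)); rewrite D0.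
  move=> w /= nw; apply: contrapT => hw; apply: nw => _; congr EFin.
  by apply/eqP; rewrite eq_le fun_ge0 andbT leNgt; exact/negP.
by move=> w /= hw; apply: lt_le_trans (hf w); rewrite lte_fin.
Qed.

Lemma lower_integral_eq0 (f : Omega -> \bar R) E : (forall w, 0 <= f w)%E ->
  (\int[P]_w f w = 0)%E -> measurable E -> (forall w, E w -> (1 <= f w)%E) -> pr P E = 0.
Proof.
move=> f0 If mE Ef; apply/eqP; rewrite eq_le pr_ge0 andbT.
suff : (P E <= \int[P]_w f w)%E by rewrite If prE.
rewrite ge0_integralTE//; apply: ereal_sup_ubound => /=; exists (indic_nnsfun R mE).
  move=> w /=; rewrite /mindic indicE; case: (boolP (w \in E)) => [|_]; last exact: f0.
  by rewrite inE => /Ef.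
exact: sintegral_indic.
Qed.

Lemma counting_ge1 (T : choiceType) (A : set T) x : A x -> (1 <= counting A :> \bar R)%E.
Proof.
move=> Ax; rewrite /counting; case: asboolP => fA; last exact: leey.
rewrite lee_fin ler1n lt0n finmap.cardfs_eq0; apply/negP => /eqP A0.
by have := in_fset_set fA x; rewrite A0 finmap.in_fset0 mem_set.
Qed.

Lemma counting_gt0 (T : choiceType) (A : set T) :
  (0 < counting A :> \bar R)%E -> A !=set0.
Proof.
by move=> h; apply/set0P/eqP => A0; move: h; rewrite A0 /counting asboolT// fset_set0 ltxx.
Qed.

End exit_event.

(** * Structure of the paths *)

Section path_structure.
Context d (Omega : measurableType d) (R : realType) (P : probability Omega R).
Variables (X : R -> Omega -> R).

(** Each [G t] has the Dirac law at 0. Countably many null sets settle the rational times, and right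
    continuity the others. *)
Lemma gaussian_levy0 G : gaussian_levy P 0 G ->
  {ae P, forall w, forall t, 0 <= t -> G t w = 0}.
Proof.
move=> [hG gG].
have Gq (q : rat) : 0 <= (ratr q : R) -> {ae P, forall w, G (ratr q) w = 0}.
  move=> q0; have := gG _ q0 [set 0] (measurable_set1 _).
  rewrite mul0r /centered_gaussian eqxx diracE mem_set// => P1.
  have m : measurable (G (ratr q) @^-1` [set 0]).
    rewrite -[X in measurable X]setTI.
    exact: (levy_measurable hG q0 measurableT (measurable_set1 0)).
  exists (~` (G (ratr q) @^-1` [set 0])); split => //; first exact: measurableC.
  by rewrite probability_setC// P1 subee.
have : {ae P, forall w, forall n,
    if unpickle n is Some q then 0 <= (ratr q : R) -> G (ratr q) w = 0 else True}.
  apply: ae_foralln => n; case: (unpickle n) => [q|]; last exact: aeW.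
  have [q0|q0] := leP 0 (ratr q : R); last by apply: aeW.
  by apply: filterS (Gq q q0).
apply: filterS => w Hw t t0; apply/eqP; rewrite -normr_le0 leNgt; apply/negP => Gt.
have [r r0 Hr] := cadlag_right (levy_cadlag hG w) t0 Gt.
have [q] := @rat_in_itvoo R t (t + r) ltac:(by rewrite ltrDl).
rewrite in_itv/= => /andP[tq qr].
have := Hw (pickle q); rewrite pickleK => /(_ (le_trans t0 (ltW tq))) Gq0.
by have := Hr (ratr q) ltac:(lra); rewrite Gq0 sub0r normrN ltxx.
Qed.

(** The positive jumps contribute 0 to [sum_jumps]; since [X t w] is real, the remaining sum is
    finite and equals [g * t - X t w]. *)
Lemma ae_pure_jump g : diffusion_drift P X 0 g ->
  {ae P, forall w, forall s, 0 < s -> jump (X ^~ w) s <= 0} ->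
  {ae P, forall w, pure_jump (fun s => Num.max (- jump (X ^~ w) s) 0)
    (fun t => g * t - X t w)}.
Proof.
move=> [_ [G [/gaussian_levy0 hG hX]]] hJ.
move: hG hX hJ; apply: filterS3 => w G0 Xw J0; split.
  by move=> s; rewrite le_max lexx orbT.
move=> t t0; have := Xw t t0; rewrite G0// addr0 /sum_jumps esum1 => [|s /= /andP[s0 _]]; last first.
  by rewrite max_r// J0.
rewrite add0e; set E := esum _ _; case: E => [e| |]//= -[->].
by congr EFin; lra.
Qed.

End path_structure.

(** * Positivity of the two exit measures *)

Theorem proposition5 (R : realType) (d : measure_display)
    (Omega : measurableType d) (P : probability Omega R)
    (F : R -> set (set Omega)) (X : R -> Omega -> R)
    (sigma2 gamma0 : R) (nu : {measure set R -> \bar R})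
    (hF : usual_conditions P F) (hXF : adapted F X)
    (hX : levy_process P X) (hnu : levy_measure P X nu)
    (hint : (\int[nu]_x (Num.min 1 `|x|)%R%:E < +oo)%E)
    (hchar : diffusion_drift P X sigma2 gamma0)
    (hsigma2 : sigma2 = 0)
    (hnu_neg : (0 < nu [set x | (x < 0)%R])%E)
    (hnu_pos : nu [set x | (0 < x)%R] = 0%E)
    (hgamma0 : 0 < gamma0)
    (M : \bar R) (hM : (0 < M)%E)
    (a b : R) (ha : 0 < a) (hb : 0 < b) :
  ((0 < lambda_plus P X a b [set t | (0 <= t)%R /\ (t%:E < M)%E])%E /\
   (0 < lambda_minus P X a b [set t | (0 <= t)%R /\ (t%:E < M)%E])%E)
  <-> ((a / gamma0)%R%:E < M)%E.
Proof.
have mX := levy_measurable hX.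
have nu_jump := hnu.2.
have pj : {ae P, forall w, pure_jump (fun s => Num.max (- jump (X ^~ w) s) 0)
    (fun t => gamma0 * t - X t w)}.
  apply: ae_pure_jump; first by rewrite hsigma2 in hchar.
  apply: ae_no_positive_jump => // E mE HE.
  have mA : measurable [set x : R | 0 < x].
    rewrite (_ : [set x | _] = [set` `]0, +oo[]); first exact: measurable_itv.
    by apply/seteqP; split => x /=; rewrite in_itv /= andbT.
  (* The number of positive jumps in ]0, 1] has mean 0. *)
  have := nu_jump _ mA; rewrite hnu_pos /= ltxx => /(_ (fun h => notF h)) /esym If.
  apply: lower_integral_eq0 If mE _ => // w /HE[s s01 js].
  exact: (@counting_ge1 _ _ _ s).
have nolevel := ae_no_jump_from_level hX hgamma0 pj a.
have Xle : {ae P, forall w, forall t, 0 <= t -> X t w <= gamma0 * t}.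
  apply: filterS pj => w pj t t0.
  by have := pure_jump_mono pj (lexx 0) t0; rewrite /= (pure_jump0 pj); lra.
have X0 : {ae P, forall w, X 0 w = 0}.
  by apply: filterS pj => w pj; have := pure_jump0 pj; rewrite /=; lra.
(* The condition on left limits holds at a by [nolevel], and at - b because X only jumps down, so
   that a left limit is never below the value. *)
have plusE : {ae P, forall w, (let T := exit_time X a b w in
    [/\ (T < +oo)%E, a <= X (fine T) w & 0 <= fine T /\ ((fine T)%:E < M)%E]) <->
    exit_up X a b M w}.
  move: (pj) (nolevel); apply: filterS2 => w pjw nl; apply: exit_upE => //.
  - exact: levy_cadlag hX w.
  - move=> s s0 Xs; rewrite le_eqVlt => /predU1P[L|//].
    by have := nl s s0 L; rewrite leNgt Xs.
  - move=> s s0 Xs _; apply: le_lt_trans Xs; rewrite lerN2.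
    apply: left_lim_ge (levy_cadlag hX w) hgamma0 s0 _ => x y.
    exact: (pure_jump_mono pjw).
have minusE : {ae P, forall w, (let T := exit_time X a b w in
    [/\ (T < +oo)%E, X (fine T) w <= - b & 0 <= fine T /\ ((fine T)%:E < M)%E]) <->
    exit_up (fun t => \- X t) b a M w}.
  move: (pj) (nolevel); apply: filterS2 => w pjw nl.
  have cX := levy_cadlag hX w.
  have eT : exit_time (fun t => \- X t) b a w = exit_time X a b w.
    congr (ereal_inf (EFin @` _)); apply/seteqP; split => t /= [t0 H]; split => //.
      by move=> H'; apply: H; lra.
    by move=> H'; apply: H; lra.
  have := @exit_upE _ _ _ (fun t => \- X t) b a M w (cadlagN cX) hb ha.
  rewrite eT => H; apply: iff_trans (H _ _).
  - cbv zeta; split=> -[H1 H2 H3]; split; [exact: H1| |exact: H3|exact: H1| |exact: H3].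
      by change (b <= - X (fine (exit_time X a b w)) w); rewrite lerNr.
    by have : b <= - X (fine (exit_time X a b w)) w := H2; rewrite lerNr.
  - move=> s s0 Xs _; have -> := left_limN cX s0; apply: le_lt_trans Xs; rewrite lerN2.
    by apply: left_lim_ge cX hgamma0 s0 _ => x y; exact: (pure_jump_mono pjw).
  - move=> s s0; have -> := left_limN cX s0; rewrite !opprK => Xs.
    rewrite le_eqVlt => /predU1P[L|//].
    by have := nl s s0 L; rewrite leNgt Xs.
have complete := usual_complete hF.
have mplus := complete_measurable complete (measurable_exit_up a b M mX) plusE.
have mminus := complete_measurable complete (measurable_exit_up b a M
  (fun t t0 => measurable_funN (mX t t0))) minusE.
split=> [[plus0 _]|aM].
  (* If M <= a / gamma0, the bound X t <= gamma0 t excludes an exit through a before M. *)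
  rewrite ltNge; apply/negP => Ma; move: plus0; apply/negP; rewrite -leNgt.
  rewrite /lambda_plus (prE P mplus) lee_fin.
  apply: (@le_trans _ _ (pr P set0)); last by rewrite /pr measure0.
  apply: pr_ae_le => //; apply: filterS Xle => w Xw [T_fin aX [T0 TM]].
  have := lt_le_trans TM Ma; rewrite lte_fin ltr_pdivlMr// mulrC.
  by rewrite ltNge (le_trans aX (Xw _ T0)).
split.
  have [t0 at0 tM] : exists2 t0 : R, a / gamma0 < t0 & (t0%:E < M)%E.
    case: M aM {hM plusE minusE mplus mminus} => [m|_|//].
      rewrite lte_fin => am; exists ((a / gamma0 + m) / 2); rewrite ?lte_fin; lra.
    by exists (a / gamma0 + 1); [lra|exact: ltry].
  have at1 : a < gamma0 * t0 by rewrite mulrC -ltr_pdivrMr.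
  have t00 : 0 < t0 by apply: lt_trans at0; exact: divr_gt0.
  (* A growth of S of at most eta up to t0 gives X t0 >= a, and X >= - b / 2 on [0, t0]: the exit
     occurs by t0 and not through - b. *)
  set eta := Num.min (gamma0 * t0 - a) (b / 2).
  have eta0 : 0 < eta by rewrite lt_min; lra.
  have [eta1 eta2] : eta <= gamma0 * t0 - a /\ eta <= b / 2.
    by rewrite /eta !ge_min !lexx orbT.
  rewrite /lambda_plus (prE P mplus) lte_fin.
  apply: lt_le_trans (pr_small_drop hX pj t00 eta0) _.
  apply: pr_ae_le => //.
    rewrite (_ : [set w | _] = [set w | (~` drop_set gamma0 eta t0) (X t0 w - X 0 w)]).
      apply: (measurable_increment hX) => //; last exact: ltW.
      exact: measurableC (@measurable_drop _ _ _ _).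
    by apply/seteqP; split => w /=; rewrite /drop_set /=; lra.
  move: (pj) (X0); apply: filterS2 => w pjw X0w /=; rewrite X0w subr0 => St.
  have Xb s : 0 <= s <= t0 -> - b < X s w.
    move=> /andP[s0 st]; have := pure_jump_mono pjw s0 st; rewrite /=.
    by have := mulr_ge0 (ltW hgamma0) s0; lra.
  have [|tau Te [taut ftau Hs]] := @exit_attained _ (X ^~ w) a b t0 (levy_cadlag hX w) (ltW t00).
    lra.
  rewrite /exit_time Te /=; split; first exact: ltry.
    by rewrite leNgt; apply/negP => Xa; apply: ftau; rewrite Xa Xb.
  split; first by case/andP: taut.
  by apply: le_lt_trans tM; rewrite lee_fin; case/andP: taut.
(* The expected number of negative jumps in ]0, 1] is positive, so some measurable event of positive
   probability carries one. *)
have [D [mD D0 HD]] : exists D, [/\ measurable D, 0 < pr P D &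
    forall w, D w -> exists2 s, 0 < s <= 1 & 0 < Num.max (- jump (X ^~ w) s) 0].
  have mA : measurable [set x : R | x < 0].
    rewrite (_ : [set x | _] = [set` `]-oo, 0[]); first exact: measurable_itv.
    by apply/seteqP; split => x /=; rewrite in_itv.
  have nuE := nu_jump _ mA; move: hnu_neg; rewrite nuE /= ?ltxx// => I0.
  have [//|D [mD D0 HD]] := lower_integral_gt0 _ I0.
  exists D; split => // w /HD /counting_gt0[s [s01 js]]; exists s => //.
  by rewrite lt_max oppr_gt0 js.
have [e e0 He] := law_drop_gt0 hX pj mD D0 HD.
have [t1 t10 [t1a t1M]] : exists2 t1 : R, 0 < t1 & t1 <= a / gamma0 /\ (t1%:E <= M)%E.
  exists (a / gamma0); first exact: divr_gt0.
  by split => //; exact: ltW.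
(* As t < a / gamma0, the drift keeps X below a up to t, while a growth of S by a + b gives X t <=
   gamma0 t - (a + b) < - b. *)
have [t [/andP[t0 tt1] Pt]] := pr_large_drop hX (a + b) e0 He t10.
have gt : gamma0 * t < a by rewrite mulrC -ltr_pdivlMr//; exact: lt_le_trans tt1 t1a.
rewrite /lambda_minus (prE P mminus) lte_fin.
apply: lt_le_trans Pt _; apply: pr_ae_le => //.
  rewrite (_ : [set w | _] = [set w | [set` `]-oo, (gamma0 * t - (a + b))]] (X t w - X 0 w)]).
    by apply: (measurable_increment hX) => //; exact: ltW.
  by apply/seteqP; split => w; rewrite /= in_itv /=; lra.
move: (Xle) (X0); apply: filterS2 => w Xw X0w /=; rewrite X0w subr0 => St.
have [|tau Te [/andP[tau0 taut] ftau Hs]] :=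
  @exit_attained _ (X ^~ w) a b t (levy_cadlag hX w) (ltW t0).
  lra.
rewrite /exit_time Te /=; split; first exact: ltry.
  rewrite leNgt; apply/negP => Xb; apply: ftau; rewrite Xb /=.
  have : gamma0 * tau <= gamma0 * t by rewrite ler_pM2l.
  by have := Xw _ tau0; lra.
split => //; apply: lt_le_trans t1M; rewrite lte_fin; exact: le_lt_trans tt1.
Qed.
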